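(* For every constant $C_1\ge2$ there exist constants $c,C>0$ depending only on $C_1$ such that, in the orthogonal group synchronization model with parameters $(n,d,p,\sigma)$, if $\frac{np}{\sigma^2}\ge c$ and $2\le d\le C_1$, then $$\inf_{\widehat Z\in\mathcal O(d)^n}\ \sup_{Z\in\mathcal O(d)^n}\mathbb E_Z\,\ell(\widehat Z,Z)\ \ge\ \left(1-C\left(\frac1n+\frac{\sigma^2}{np}\right)\right)\frac{\sigma^2d(d-1)}{2np}.$$
   Context: Here $n\ge2$, $d$ are integers, $p\in(0,1]$, $\sigma>0$. $\mathcal O(d)=\{U\in\mathbb R^{d\times d}:UU^T=U^TU=I_d\}$; $\|\cdot\|_F$ is the Frobenius norm. Model: for a parameter $Z=(Z_1,\dots,Z_n)\in\mathcal O(d)^n$, let $Y_{ij}=Z_iZ_j^{T}+\sigma W_{ij}\in\mathbb R^{d\times d}$ for $1\le i<j\le n$, where the $W_{ij}$ are independent $d\times d$ matrices with i.i.d. $N(0,1)$ entries. Independently of the $W_{ij}$, let $A_{ij}\sim\mathrm{Bernoulli}(p)$ be independent for $1\le i<j\le n$. One observes $\{A_{ij}\}$ and those $Y_{ij}$ with $A_{ij}=1$. $\mathbb E_Z$ denotes expectation when the true parameter is $Z$; the infimum is over all estimators, i.e. measurable $\mathcal O(d)^n$-valued functions of the observed data. Loss: $\ell(\widehat Z,Z)=\min_{B\in\mathcal O(d)}\frac1n\sum_{i=1}^n\|\widehat Z_i-Z_iB\|_F^2$. *)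

(* Defs.v *)
From HB Require Import structures.
From mathcomp Require Import all_boot all_order all_algebra.
From mathcomp Require Import all_classical all_reals all_analysis.

Set Implicit Arguments.
Unset Strict Implicit.
Unset Printing Implicit Defensive.

Import Order.TTheory GRing.Theory Num.Theory.
Import numFieldNormedType.Exports.

Local Open Scope classical_set_scope.
Local Open Scope ring_scope.

Definition orthogonal_group (R : realType) (d : nat) : set 'M[R]_d :=
  [set U | U *m U^T = 1%:M /\ U^T *m U = 1%:M].

(* The norm that the library puts on matrices is the max norm. *)
Definition frobenius_norm (R : realType) (m n : nat) (M : 'M[R]_(m, n)) : R :=
  Num.sqrt (\sum_i \sum_j M i j ^+ 2).

Definition parameter_space (R : realType) (n d : nat) : set ('I_n -> 'M[R]_d) :=
  [set Z | forall i, orthogonal_group (Z i)].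

(* The infimum over B is attained: a continuous function is minimized over
   the nonempty compact set O(d). *)
Definition sync_loss (R : realType) (n d : nat) (Zhat Z : 'I_n -> 'M[R]_d) : R :=
  inf [set n%:R^-1 * \sum_(i < n) frobenius_norm (Zhat i - Z i *m B) ^+ 2
      | B in @orthogonal_group R d].

Definition edge (n : nat) : finType := {e : 'I_n * 'I_n | (e.1 < e.2)%N}.

Definition edge_fst (n : nat) (e : edge n) : 'I_n := (val e).1.
Definition edge_snd (n : nat) (e : edge n) : 'I_n := (val e).2.

(* Mutual independence of a finite family of classes of events. *)
Definition independent_classes (disp : measure_display) (T : measurableType disp)
    (R : realType) (P : probability T R) (I : finType)
    (F : I -> set (set T)) : Prop :=
  forall (J : {set I}) (E : I -> set T), (forall i, i \in J -> F i (E i)) ->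
    P (\bigcap_(i in [set` J]) E i) = (\prod_(i in J) P (E i))%E.

Definition sigma_of (disp disp' : measure_display) (T : measurableType disp)
    (T' : measurableType disp') (X : T -> T') : set (set T) :=
  preimage_set_system setT X measurable.

(* All the variables A_e and all the entries W_e k l form a single mutually
   independent family; this includes the independence of A from W. *)
Definition sync_sigma (disp : measure_display) (T : measurableType disp)
    (R : realType) (P : probability T R) (n d : nat)
    (A : edge n -> {RV P >-> bool})
    (W : edge n -> 'I_d -> 'I_d -> {RV P >-> R})
    (i : edge n + edge n * ('I_d * 'I_d)) : set (set T) :=
  match i with
  | inl e => sigma_of (A e)
  | inr (e, (k, l)) => sigma_of (W e k l)
  end.

Record sync_model (disp : measure_display) (T : measurableType disp)
    (R : realType) (P : probability T R) (n d : nat) (p : R)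
    (A : edge n -> {RV P >-> bool})
    (W : edge n -> 'I_d -> 'I_d -> {RV P >-> R}) : Prop := SyncModel {
  sync_bernoulli : forall (e : edge n) (B : set bool),
    measurable B -> distribution P (A e) B = bernoulli_prob p B ;
  sync_gaussian : forall (e : edge n) (k l : 'I_d) (B : set R),
    measurable B -> distribution P (W e k l) B = normal_prob 0 1 B ;
  sync_independent : independent_classes P (sync_sigma A W)
}.

(* A data set: None at e means A_e = 0, and Some y means A_e = 1, Y_e = y. *)
Definition data (R : realType) (n d : nat) := edge n -> option 'M[R]_d.

Definition observed (R : realType) (n d : nat) (sigma : R) (Z : 'I_n -> 'M[R]_d)
    (a : edge n -> bool) (w : edge n -> 'I_d -> 'I_d -> R) : data R n d :=
  fun e => if a e then
    Some (Z (edge_fst e) *m (Z (edge_snd e))^T + sigma *: \matrix_(k, l) w e k l)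
  else None.

(* The Borel sigma-algebra of the space of data sets is generated by these
   events; B = setT gives the event A_e = 1 (when d > 0). *)
Definition data_cylinders (R : realType) (n d : nat) : set (set (data R n d)) :=
  [set C | exists (e : edge n) (k l : 'I_d) (B : set R), measurable B /\
    C = [set y : data R n d | exists2 M, y e = Some M & B (M k l)]].

Definition estimator (R : realType) (n d : nat) :
    set (data R n d -> 'I_n -> 'M[R]_d) :=
  [set Zhat | (forall y, parameter_space (Zhat y)) /\
    forall (i : 'I_n) (k l : 'I_d), measurable_fun setT
      (fun y : g_sigma_algebraType (@data_cylinders R n d) => Zhat y i k l)].

Definition sync_risk (disp : measure_display) (T : measurableType disp)
    (R : realType) (P : probability T R) (n d : nat) (sigma : R)
    (A : edge n -> {RV P >-> bool})
    (W : edge n -> 'I_d -> 'I_d -> {RV P >-> R})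
    (Zhat : data R n d -> 'I_n -> 'M[R]_d) (Z : 'I_n -> 'M[R]_d) : \bar R :=
  'E_P[fun t => sync_loss
         (Zhat (observed sigma Z (fun e => A e t) (fun e k l => W e k l t))) Z].

Definition minimax_risk (disp : measure_display) (T : measurableType disp)
    (R : realType) (P : probability T R) (n d : nat) (sigma : R)
    (A : edge n -> {RV P >-> bool})
    (W : edge n -> 'I_d -> 'I_d -> {RV P >-> R}) : \bar R :=
  ereal_inf [set ereal_sup [set sync_risk sigma A W Zhat Z
                           | Z in @parameter_space R n d]
            | Zhat in @estimator R n d].

(* Main.v *)
(** The loss dominates [(2 n^2)^-1 * sum_ij |T_ij - Z_i Z_j^T|^2] with
    [T_ij = Zhat_i Zhat_j^T], which does not involve the global rotation.  Fix a
    pair [i, j] and put [Q = Z_i^T T_ij Z_j].  Rotating [Z_i] and [Z_j] in opposite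
    directions by an angle [t] in the coordinate plane [(k, l)] changes
    [Q_kl - Q_lk] at the rate [-2 (Q_kk + Q_ll)], while the chi-square divergence
    between the two laws of the data is about [4 (n p / sigma^2) t^2].  Under a
    prior that is invariant by rotations the mean of [Q_kl - Q_lk] does not
    change, so changing measure, applying AM-GM to the likelihood ratio and summing
    over [k <> l] gives [r (n p / sigma^2 + d - 1) >= d (d - 1)] for the average
    [r] of [|T_ij - Z_i Z_j^T|^2]; this is a van Trees inequality with finite
    differences and without a prior information term.

    In place of the Haar measure the prior is the uniform measure on an eps-net of
    [O(d)^n] of minimal cardinality.  Minimality is Hall's condition for matching
    the net with any of its translates at distance of order eps, so the prior is
    almost invariant; eps tends to 0 first, then [t]. *)

Require Import Defs.
From HB Require Import structures.
From mathcomp Require Import all_boot all_order all_algebra.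
From mathcomp Require Import all_classical all_reals all_analysis.
From mathcomp Require Import measurable_realfun.
From mathcomp Require Import ring lra zify.

Set Implicit Arguments.
Unset Strict Implicit.
Unset Printing Implicit Defensive.

Import Order.TTheory GRing.Theory Num.Theory.
Import numFieldNormedType.Exports.

Local Open Scope classical_set_scope.
Local Open Scope ring_scope.

(** * Likelihood ratios *)

(** The leading constant must be sharp, and this fixes several choices. Turning both ends of the
    pair doubles the drift of the statistic while the divergence only doubles; turning one end alone
    would lose a factor two. The inequality between the squares of the skew entries and
    [4 |Q - 1|^2] is an equality to first order, because an orthogonal matrix near the identity is
    the identity plus a skew matrix. AM-GM serves better than Cauchy-Schwarz because its bound is
    affine in the second moment of the statistic, hence can be summed over planes and averaged over
    the prior with one weight [lam]. The weight [mu * s], with [mu = n p / sigma^2] and [s] the sine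
    of the angle, balances its two terms at the target risk [d (d - 1) / mu]. Terms of order [s]
    survive a division by [s]; errors of order [s^2], the defect of invariance of the prior among
    them, vanish with [s]. The net is chosen after [s], so fine that matched points have means of
    the statistic within [s^2]; for an arbitrary estimator this continuity again comes from the
    change of measure. *)

Section density.
Local Open Scope ereal_scope.
Context d d' (T : measurableType d) (U : measurableType d') (R : realType).
Variables (mu : {measure set T -> \bar R}) (phi : T -> U) (L : T -> R).
Hypotheses (mphi : measurable_fun setT phi) (mL : measurable_fun setT L).
Hypothesis L0 : forall x, (0 <= L x)%R.

Import HBNNSimple.

Let nu (B : set U) := \int[mu]_(x in phi @^-1` B) (L x)%:E.

Let nu0 : nu set0 = 0.
Proof. by rewrite /nu preimage_set0 integral_set0. Qed.

Let nu_ge0 B : 0 <= nu B.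
Proof. by apply: integral_ge0 => x _; rewrite lee_fin. Qed.

Let mpre B : measurable B -> measurable (phi @^-1` B).
Proof. by move=> mB; rewrite -[X in measurable X]setTI; exact: mphi. Qed.

Let nu_additive : semi_sigma_additive nu.
Proof.
move=> /= F mF tF mUF.
rewrite /nu preimage_bigcup ge0_integral_bigcup//=.
- by apply: is_cvg_ereal_nneg_natsum_cond => n _ _; exact: nu_ge0.
- by move=> i; exact: mpre.
- by apply/measurable_EFinP; apply: measurable_funTS.
- by move=> x _; rewrite lee_fin.
- by move=> i j _ _ [x [Fi Fj]]; apply: (tF i j) => //; exists (phi x).
Qed.

(** It turns equalities of integrals into equalities of measures, which a generating class of sets
    decides. [L = 1] gives an image measure, [phi] the identity gives a density; both are used. *)
Lemma density_measure : exists nu : {measure set U -> \bar R},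
  (forall B, nu B = \int[mu]_(x in phi @^-1` B) (L x)%:E) /\
  (forall G : U -> R, measurable_fun setT G -> (forall u, (0 <= G u)%R) ->
    \int[nu]_u (G u)%:E = \int[mu]_x (G (phi x) * L x)%:E).
Proof.
pose nu_mixin := isMeasure.Build _ _ _ nu nu0 nu_ge0 nu_additive.
pose nu' : {measure set U -> \bar R} := HB.pack nu nu_mixin.
exists nu'; split => // G mG G0.
have mGE : measurable_fun setT (EFin \o G) by exact/measurable_EFinP.
pose h := nnsfun_approx measurableT mGE.
have hG u : (EFin \o h^~ u) n @[n --> \oo] --> (G u)%:E.
  by apply: cvg_nnsfun_approx => // t _; rewrite lee_fin.
have hnd u : {homo (fun n => h n u) : m n / (m <= n)%N >-> (m <= n)%R}.
  by move=> m n mn; exact/lefP/nd_nnsfun_approx.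
transitivity (limn (fun n => \int[nu']_u (h n u)%:E)).
  rewrite -monotone_convergence//.
  - by apply: eq_integral => u _; apply/esym/cvg_lim => //; exact: hG.
  - by move=> n; apply/measurable_EFinP.
  - by move=> n u _; rewrite lee_fin.
  - by move=> u _ m n mn; rewrite lee_fin hnd.
transitivity (limn (fun n => \int[mu]_x (h n (phi x) * L x)%:E)); last first.
  rewrite -monotone_convergence//.
  - apply: eq_integral => x _; apply/cvg_lim => //.
    rewrite EFinM; under eq_fun do rewrite EFinM.
    by apply: cvgeZr => //; exact: hG.
  - move=> n; apply/measurable_EFinP; apply: measurable_funM => //.
    exact: measurableT_comp.
  - by move=> n x _; rewrite lee_fin mulr_ge0.
  - by move=> x _ m n mn; rewrite lee_fin ler_wpM2r ?hnd.
congr (limn _); apply/funext => n.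
have mr r : measurable (h n @^-1` [set r]) by [].
under eq_integral do rewrite fimfunE -fsumEFin//.
rewrite ge0_integral_fsum//; last 2 first.
- by move=> y; apply/measurable_EFinP; exact: measurable_funM.
- by move=> y u _; exact: nnfun_muleindic_ge0.
under [RHS]eq_integral => x _.
  rewrite fimfunE EFinM -fsumEFin// ge0_mule_fsuml; last first.
    by move=> y; exact: nnfun_muleindic_ge0.
  over.
rewrite ge0_integral_fsum//; last 2 first.
- move=> y; apply: emeasurable_funM; last exact/measurable_EFinP.
  apply/measurable_EFinP; apply: measurable_funM => //.
  exact: (measurableT_comp (measurable_indic (mr y)) mphi).
- by move=> y x _; rewrite mule_ge0 ?lee_fin//; exact: nnfun_muleindic_ge0.
apply: eq_fsbigr => r; rewrite inE => -[u _ <-].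
rewrite integralZl_indic_nnsfun// integral_indic// setIT.
under [RHS]eq_integral do rewrite EFinM -muleA.
rewrite ge0_integralZl ?lee_fin//; last 2 first.
- apply: emeasurable_funM; last exact/measurable_EFinP.
  apply/measurable_EFinP.
  exact: (measurableT_comp (measurable_indic (mr _)) mphi).
- by move=> x _; rewrite mule_ge0 ?lee_fin.
congr (_ * _); rewrite [LHS]integral_mkcond; congr integral; apply/funext => x.
by rewrite epatch_indic /= muleC.
Qed.
End density.

(** * Expectation of a product of independent variables *)

Section independence.
Local Open Scope ereal_scope.
Context d (T : measurableType d) (R : realType) (P : probability T R).
Variables (I : finType) (F : I -> set (set T)).
Hypothesis indep : independent_classes P F.
Variables (f : I -> T -> R) (m : I -> R).
Hypothesis mf : forall i, measurable_fun setT (f i).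
Hypothesis Ff : forall i B, measurable B -> F i (f i @^-1` B).
Hypothesis f0 : forall i x, (0 <= f i x)%R.
Hypothesis fm : forall i, \int[P]_x (f i x)%:E = (m i)%:E.

(** Interpolates between indicators, where independence is assumed, and the functions [f i], which
    the indices in [s] already carry. *)
Let mixed (s : seq I) (B : I -> set R) i x : R :=
  if i \in s then f i x else \1_(f i @^-1` (B i)) x.

Let mixed_mean (s : seq I) (B : I -> set R) i : R :=
  if i \in s then m i else fine (P (f i @^-1` (B i))).

Let mpre i (B : set R) : measurable B -> measurable (f i @^-1` B).
Proof. by move=> mB; rewrite -[X in measurable X]setTI; exact: mf. Qed.

Let measurable_mixed s B i : (forall i, measurable (B i)) ->
  measurable_fun setT (mixed s B i).
Proof.
move=> mB; rewrite /mixed; case: (i \in s); first exact: mf.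
by apply: measurable_indic; exact: mpre.
Qed.

Let mixed_ge0 s B i x : (0 <= mixed s B i x)%R.
Proof. by rewrite /mixed; case: ifP => _; rewrite ?f0// indicE. Qed.

(** Induction on [s], for all [B] at once. Letting [B i] vary in the induction hypothesis shows that
    the law of [f i] weighted by the other factors equals the law of [f i] times a constant.
    Integrating the identity function against both replaces the indicator at [i] by [f i]. *)
Let integral_mixed s (B : I -> set R) : (forall i, measurable (B i)) ->
  \int[P]_x (\prod_i mixed s B i x)%:E = (\prod_i mixed_mean s B i)%:E.
Proof.
elim: s B => [|i s IH] B mB.
  pose C := \bigcap_(i in [set` [set: I]%SET]) (f i @^-1` (B i)).
  transitivity (\int[P]_x (\1_C x)%:E).
    apply: eq_integral => x _; congr EFin; rewrite /mixed indicE.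
    have [xB|xB] := boolP (x \in C).
      rewrite big1// => i _; rewrite indicE mem_set//.
      by move: xB; rewrite inE => /(_ i); apply; rewrite /= inE.
    have [i Hi] : exists i, ~ (f i @^-1` B i) x.
      by apply/existsNP => h; move: xB; rewrite notin_setE; apply => i _; exact: h.
    by apply/eqP/prodf_eq0; exists i; rewrite //= indicE memNset.
  have mC : measurable C.
    by apply: fin_bigcap_measurable => // i _; exact: mpre.
  rewrite integral_indic// setIT.
  transitivity (\prod_(i in [set: I]%SET) P (f i @^-1` (B i))).
    by apply: indep => i _; exact: Ff.
  rewrite -prodEFin; apply: eq_big => [i|i _]; first by rewrite finset.in_setT.
  by rewrite /mixed_mean fineK// fin_num_measure//; exact: mpre.
have [i_s|i_s] := boolP (i \in s).
  have e j : (j \in i :: s) = (j \in s).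
    by rewrite inE; case: eqP => // ->; rewrite i_s.
  rewrite /mixed /mixed_mean; under eq_integral do under eq_bigr do rewrite e.
  by under [in RHS]eq_bigr do rewrite e; exact: IH.
pose L x : R := (\prod_(j | j != i) mixed s B j x)%R.
pose c : R := (\prod_(j | j != i) mixed_mean s B j)%R.
have mL : measurable_fun setT L.
  rewrite /L; under eq_fun do rewrite big_mkcond.
  by apply: measurable_prod => j _; case: (j != i) => //; exact: measurable_mixed.
have L0 x : (0 <= L x)%R by apply: prodr_ge0.
have c0 : (0 <= c)%R.
  apply: prodr_ge0 => j _; rewrite /mixed_mean; case: ifP => _; last exact: fine_ge0.
  by rewrite -lee_fin -fm; apply: integral_ge0 => x _; rewrite lee_fin.
have [nu [nuE nuG]] := density_measure P (mf i) mL L0.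
have [nu' [nuE' nuG']] := density_measure P (mf i) (measurable_cst c) (fun=> c0).
have nn B' : measurable B' -> nu B' = nu' B'.
  move=> mB'; rewrite nuE nuE'.
  pose B2 j := if j == i then B' else B j.
  have mB2 j : measurable (B2 j) by rewrite /B2; case: ifP.
  have := IH B2 mB2; rewrite (bigD1 i)//= {1}/mixed_mean (negbTE i_s) /B2 eqxx -/B2.
  rewrite (eq_bigr (mixed_mean s B)); last first.
    by move=> j /negbTE ji; rewrite /mixed_mean /B2 ji.
  rewrite -/c integral_cst; last exact: mpre.
  rewrite EFinM fineK ?fin_num_measure//; last exact: mpre.
  rewrite muleC => <-.
  rewrite integral_mkcond; apply: eq_integral => x _.
  rewrite epatch_indic/= -EFinM (bigD1 i)//= {1}/mixed (negbTE i_s) /B2 eqxx mulrC.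
  congr (_ * _)%:E; apply: eq_bigr => j /negbTE ji.
  by rewrite /mixed ji.
(* [density_measure] asks for an integrand that is non-negative on the whole line; the absolute
   value agrees with the identity on the values of [f i]. *)
have h1 : \int[nu]_u (`|u|%R)%:E = \int[nu']_u (`|u|%R)%:E.
  by apply: eq_measure_integral => A mA _; exact: nn.
rewrite nuG// nuG'// in h1.
rewrite (bigD1 i)//= {1}/mixed_mean inE eqxx/=.
rewrite (eq_bigr (mixed_mean s B)); last first.
  by move=> j /negbTE ji; rewrite /mixed_mean inE ji.
rewrite -/c EFinM -fm -ge0_integralZr//; last 2 first.
- exact/measurable_EFinP.
- by move=> x _; rewrite lee_fin.
transitivity (\int[P]_x (`|f i x| * L x)%:E).
  apply: eq_integral => x _; congr EFin.
  rewrite (bigD1 i)//= {1}/mixed inE eqxx/= ger0_norm//; congr (_ * _)%R.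
  by apply: eq_bigr => j /negbTE ji; rewrite /mixed inE ji.
by rewrite h1; apply: eq_integral => x _; rewrite ger0_norm// EFinM.
Qed.

Lemma independent_integral_prod :
  \int[P]_x (\prod_i f i x)%:E = (\prod_i m i)%:E.
Proof.
have := @integral_mixed (index_enum I) (fun=> setT) (fun=> measurableT).
rewrite /mixed /mixed_mean; under eq_integral do under eq_bigr do rewrite mem_index_enum.
by under [in X in _ = X]eq_bigr do rewrite mem_index_enum.
Qed.
End independence.

(** * Translation of a standard Gaussian *)

Section gaussian_shift.
Local Open Scope ereal_scope.
Context (R : realType).
Notation mu := (@lebesgue_measure R).

Lemma measurable_shift (a : R) : measurable_fun setT (fun x : R => x + a)%R.
Proof. exact: measurable_funD. Qed.

(** The values on half-open intervals determine Lebesgue measure, and translation preserves their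
    lengths. *)
Lemma lebesgue_measure_shift (a : R) (B : set R) : measurable B ->
  mu ((fun x => x + a)%R @^-1` B) = mu B.
Proof.
move=> mB; pose phi : measurableTypeR R -> measurableTypeR R := fun x => (x + a)%R.
have mphi : measurable_fun setT phi by exact: measurable_shift.
have [nu [nuE _]] := density_measure mu mphi (measurable_cst (1%R : R)) (fun=> ler01).
have mphiB C : measurable C -> measurable (phi @^-1` C).
  by move=> mC; rewrite -[X in measurable X]setTI; exact: mphi.
have nuE' C : measurable C -> nu C = mu (phi @^-1` C).
  by move=> mC; rewrite nuE -[RHS]mul1e -(integral_cst mu (mphiB _ mC) 1).
transitivity (nu B); first by rewrite nuE'.
symmetry; apply: (@lebesgue_measure_unique R nu) => // X [[x y] /= _ <-].
rewrite nuE'; last exact: (@measurable_itv R (Interval (BRight x) (BRight y))).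
rewrite (_ : _ @^-1` _ = `](x - a)%R, (y - a)%R]%classic); last first.
  by apply/seteqP; split => z /=; rewrite !in_itv/= /phi ltrBlDr lerBrDr.
rewrite !lebesgue_measure_itv/= !lte_fin ltrD2r.
by case: ifP => // _; rewrite -!EFinB; congr EFin; ring.
Qed.

(* The density of N(a, 1) with respect to N(0, 1). *)
Definition tilt (a x : R) : R := expR (a * x - a ^+ 2 / 2).

Lemma tilt_ge0 a x : (0 <= tilt a x)%R. Proof. exact: expR_ge0. Qed.

Lemma measurable_tilt a : measurable_fun setT (tilt a).
Proof.
by apply: measurableT_comp => //; exact: measurable_funB.
Qed.

(** Since [tilt (2 * a)] has mean 1, the factor [expR (a ^+ 2)] is the second moment of the
    likelihood ratio of a shift by [a]. *)
Lemma tilt_sqr a x : (tilt a x ^+ 2 = expR (a ^+ 2) * tilt (2 * a) x)%R.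
Proof. by rewrite /tilt -expRD -expRM_natl; congr expR; field. Qed.

Lemma normal_pdf_tilt a x : (tilt a x * normal_pdf 0 1 x = normal_pdf 0 1 (x - a))%R.
Proof.
rewrite !normal_pdfE ?oner_neq0// mulrCA; congr (_ * _)%R.
by rewrite /tilt /normal_fun -expRD expr1n; congr expR; field.
Qed.

(** Both sides are the Lebesgue integral over [B] of the normal density centred at [a]. *)
Lemma normal_shift (a : R) (B : set R) : measurable B ->
  \int[normal_prob 0 1]_x (\1_B x * tilt a x)%:E =
  normal_prob 0 1 ((fun x => x + a)%R @^-1` B).
Proof.
move=> mB.
have mpdf : measurable_fun setT (normal_pdf (0%R : R) 1) by exact: measurable_normal_pdf.
have pdf0 (x : R) : (0 <= normal_pdf 0 1 x)%R by exact: normal_pdf_ge0.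
have [nu [nuE nuG]] := density_measure mu (@measurable_id _ _ setT) mpdf pdf0.
have mG : measurable_fun setT (fun x => \1_B x * tilt a x)%R.
  by apply: measurable_funM; [exact: measurable_indic|exact: measurable_tilt].
have G0 x : (0 <= \1_B x * tilt a x)%R by rewrite mulr_ge0 ?tilt_ge0// indicE.
transitivity (\int[nu]_x (\1_B x * tilt a x)%:E).
  by apply: eq_measure_integral => A mA _; rewrite nuE.
rewrite nuG//.
pose h (y : R) : R := (\1_B y * normal_pdf 0 1 (y - a))%R.
have mh : measurable_fun setT h.
  apply: measurable_funM; first exact: measurable_indic.
  by apply: measurableT_comp => //; exact: measurable_funB.
have h0 x : (0 <= h x)%R by rewrite mulr_ge0// indicE.
pose phi : measurableTypeR R -> measurableTypeR R := fun x => (x + a)%R.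
have mphi : measurable_fun setT phi by exact: measurable_shift.
have [nu' [nuE' nuG']] := density_measure mu mphi (measurable_cst (1%R : R)) (fun=> ler01).
transitivity (\int[mu]_x (h x)%:E).
  by apply: eq_integral => x _; rewrite -mulrA normal_pdf_tilt.
transitivity (\int[nu']_x (h x)%:E).
  apply: eq_measure_integral => A mA _.
  have mphiA : measurable (phi @^-1` A) by rewrite -[X in measurable X]setTI; exact: mphi.
  transitivity (1 * mu (phi @^-1` A)).
    by rewrite mul1e; symmetry; exact: lebesgue_measure_shift.
  by rewrite nuE' -(integral_cst mu mphiA 1).
rewrite nuG'// /normal_prob [RHS]integral_mkcond; apply: eq_integral => x _.
by rewrite epatch_indic/= -EFinM mulr1 /h /phi addrK mulrC.
Qed.

Lemma integral_tilt (a : R) : \int[normal_prob 0 1]_x (tilt a x)%:E = 1.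
Proof.
have := @normal_shift a setT measurableT; rewrite preimage_setT.
rewrite probability_setT => <-; apply: eq_integral => x _.
by rewrite indicT mul1r.
Qed.

End gaussian_shift.

(** * Independence of the edges and the noise *)

Section model_independence.
Local Open Scope ereal_scope.
Context disp (T : measurableType disp) (R : realType) (P : probability T R).
Variables (n d : nat) (p : R) (A : edge n -> {RV P >-> bool})
  (W : edge n -> 'I_d -> 'I_d -> {RV P >-> R}).
Hypotheses (p_ge0 : (0 <= p)%R) (p_le1 : (p <= 1)%R) (AW : sync_model p A W).

Notation K := (edge n * ('I_d * 'I_d))%type.

Definition noise (q : K) (t : T) : R := W q.1 q.2.1 q.2.2 t.

(** The indicator that the observed graph is [a], written with one factor per edge so that
    independence applies to it. *)
Definition edges_are (a : edge n -> bool) (t : T) : R :=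
  (\prod_e (A e t == a e)%:R)%R.

Definition bernoulli_weight (b : bool) : R := (if b then p else 1 - p)%R.

Lemma measurable_noise q : measurable_fun setT (noise q).
Proof. exact: measurable_funP. Qed.

Lemma measurable_edge e b : measurable_fun setT (fun t => (A e t == b)%:R : R).
Proof.
rewrite (_ : (fun t => _) = \1_((A e : T -> bool) @^-1` [set b]) :> (T -> R)).
  by apply: measurable_indic; rewrite -[X in measurable X]setTI; exact: measurable_funP.
apply/funext => t; rewrite indicE; congr (nat_of_bool _)%:R.
by apply/eqP/idP => [h|]; rewrite inE.
Qed.

Lemma measurable_edges_are a : measurable_fun setT (edges_are a).
Proof. by apply: measurable_prod => e _; exact: measurable_edge. Qed.

Lemma edges_are_ge0 a t : (0 <= edges_are a t)%R.
Proof. by apply: prodr_ge0. Qed.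

Lemma integral_edge e b :
  \int[P]_t ((A e t == b)%:R)%:E = (bernoulli_weight b)%:E.
Proof.
have mA : measurable ((A e : T -> bool) @^-1` [set b]).
  by rewrite -[X in measurable X]setTI; exact: measurable_funP.
transitivity (\int[P]_t (\1_((A e : T -> bool) @^-1` [set b]) t)%:E).
  apply: eq_integral => t _; congr EFin; rewrite indicE; congr (nat_of_bool _)%:R.
  by apply/eqP/idP => [h|]; rewrite inE.
rewrite integral_indic// setIT.
transitivity (bernoulli_prob p [set b]).
  exact: (sync_bernoulli AW e (B := [set b])).
rewrite bernoulli_probE ?p_ge0// !diracE /bernoulli_weight.
by rewrite !in_set1; case: b mA => _; rewrite /= ?mule1 ?mule0 ?adde0 ?add0e.
Qed.

Lemma integral_noise q (g : R -> R) : measurable_fun setT g ->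
  (forall x, (0 <= g x)%R) ->
  \int[P]_t (g (noise q t))%:E = \int[normal_prob 0 1]_x (g x)%:E.
Proof.
move=> mg g0.
have mphi : measurable_fun setT (noise q : T -> measurableTypeR R).
  exact: measurable_noise.
have [nu [nuE nuG]] := density_measure P mphi (measurable_cst (1%R : R)) (fun=> ler01).
transitivity (\int[nu]_x (g x)%:E).
  by rewrite nuG//; apply: eq_integral => t _; rewrite mulr1.
apply: eq_measure_integral => B mB _.
have mW : measurable (noise q @^-1` B) by rewrite -[X in measurable X]setTI; exact: mphi.
transitivity (P (noise q @^-1` B)); last exact: (sync_gaussian AW).
by rewrite nuE -[RHS]mul1e -(integral_cst P mW 1).
Qed.

(** On the event that the graph is [a], the noise entries are still independent standard Gaussians;
    this is the form in which [shift_integral] takes independence. *)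
Lemma model_integral_prod (a : edge n -> bool) (g : K -> R -> R) (m : K -> R) :
  (forall q, measurable_fun setT (g q)) -> (forall q x, (0 <= g q x)%R) ->
  (forall q, \int[normal_prob 0 1]_x (g q x)%:E = (m q)%:E) ->
  \int[P]_t (edges_are a t * \prod_q g q (noise q t))%:E =
  ((\prod_e bernoulli_weight (a e)) * \prod_q m q)%:E.
Proof.
move=> mg g0 gm.
pose f (i : edge n + K) t : R :=
  match i with inl e => (A e t == a e)%:R | inr q => g q (noise q t) end.
pose m' (i : edge n + K) :=
  match i with inl e => bernoulli_weight (a e) | inr q => m q end.
have := @independent_integral_prod _ T R P _ (sync_sigma A W)
  (sync_independent AW) f m'.
rewrite big_sumType/= => <-.
- by apply: eq_integral => t _; rewrite big_sumType.
- move=> [e|q]; first exact: measurable_edge.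
  by apply: measurableT_comp => //; exact: measurable_noise.
- move=> [e|[e [k l]]] B mB /=.
    exists [set b | B (b == a e)%:R] => //; first by rewrite setTI.
  exists (g (e, (k, l)) @^-1` B); last by rewrite setTI.
  by rewrite -[X in measurable X]setTI; exact: mg.
- by move=> [e|q] t /=.
- move=> [e|q] /=; first exact: integral_edge.
  by rewrite integral_noise.
Qed.

End model_independence.

(** * Translation of a finite family of Gaussians *)

Section shifted_noise.
Local Open Scope ereal_scope.
Context (R : realType) (K : finType).

Definition rectangles : set (set (K -> R)) :=
  [set C | exists B : K -> set R, (forall q, measurable (B q)) /\
    C = [set w | forall q, B q (w q)]].

Notation noise_space := (g_sigma_algebraType rectangles).

Lemma rectangles_setI : setI_closed rectangles.
Proof.
move=> _ _ [B [mB ->]] [B' [mB' ->]].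
exists (fun q => B q `&` B' q); split; first by move=> q; exact: measurableI.
apply/seteqP; split => w /=; first by move=> [h h'] q; split.
by move=> h; split => q; have [] := h q.
Qed.

Lemma measurable_to_noise disp (T : measurableType disp) (f : K -> T -> R) :
  (forall q, measurable_fun setT (f q)) ->
  measurable_fun setT (fun t => (fun q => f q t) : noise_space).
Proof.
move=> mf; apply: (@measurability _ _ T noise_space setT _ rectangles) => // _ [_ [B [mB ->]] <-].
rewrite setTI (_ : _ @^-1` _ = \bigcap_(q in setT) (f q @^-1` (B q))); last first.
  by apply/seteqP; split => t /= h q; [move=> _|]; exact: h.
apply: fin_bigcap_measurable => // q _.
by rewrite -[X in measurable X]setTI; exact: mf.
Qed.

Lemma measurable_coord q : measurable_fun setT (fun w : noise_space => w q).
Proof.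
move=> _ B mB; rewrite setTI; apply: sub_sigma_algebra.
exists (fun q' => if q' == q then B else setT); split.
  by move=> q'; case: ifP.
apply/seteqP; split => w /=.
  by move=> Bw q'; case: eqP => [->|].
by move=> /(_ q); rewrite eqxx.
Qed.

Context disp (T : measurableType disp) (P : probability T R).
Variables (X : K -> T -> R) (V : T -> R) (c : R).
Hypotheses (mX : forall q, measurable_fun setT (X q)) (mV : measurable_fun setT V).
Hypothesis V0 : forall t, (0 <= V t)%R.
Hypothesis XV : forall (g : K -> R -> R) (m : K -> R),
  (forall q, measurable_fun setT (g q)) -> (forall q x, (0 <= g q x)%R) ->
  (forall q, \int[normal_prob 0 1]_x (g q x)%:E = (m q)%:E) ->
  \int[P]_t (V t * \prod_q g q (X q t))%:E = (c * \prod_q m q)%:E.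

(** A finite-dimensional Cameron-Martin formula. [XV] says that under the weight [V], later the
    indicator of a graph, the [X q] are independent standard Gaussians of total mass [c]. The two
    sides are integrals of [G] against finite measures that agree on rectangles by the
    one-dimensional shift, hence everywhere. *)
Lemma shift_integral (delta : K -> R) (G : noise_space -> R) :
  measurable_fun setT G -> (forall w, (0 <= G w)%R) ->
  \int[P]_t (G (fun q => X q t + delta q) * V t)%:E =
  \int[P]_t (G (fun q => X q t) * (V t * \prod_q tilt (delta q) (X q t)))%:E.
Proof.
move=> mG G0.
have mphi1 : measurable_fun setT (fun t => (fun q => X q t + delta q)%R : noise_space).
  by apply: (@measurable_to_noise _ _ (fun q t => X q t + delta q)%R) => q; exact: measurable_funD.
have mphi2 : measurable_fun setT (fun t => (fun q => X q t) : noise_space).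
  exact: measurable_to_noise.
have mL : measurable_fun setT (fun t => V t * \prod_q tilt (delta q) (X q t))%R.
  apply: measurable_funM => //; apply: measurable_prod => q _.
  by apply: measurableT_comp => //; exact: measurable_tilt.
have L0 t : (0 <= V t * \prod_q tilt (delta q) (X q t))%R.
  by rewrite mulr_ge0// prodr_ge0// => q _; exact: tilt_ge0.
have [nu1 [nu1E nu1G]] := density_measure P mphi1 mV V0.
have [nu2 [nu2E nu2G]] := density_measure P mphi2 mL L0.
rewrite -nu1G// -nu2G//.
apply: eq_measure_integral => C mC _.
have rectE (B : K -> set R) : (forall q, measurable (B q)) ->
    nu1 [set w | forall q, B q (w q)] = nu2 [set w | forall q, B q (w q)] /\
    (nu1 [set w | forall q, B q (w q)] < +oo).
  move=> mB.
  pose m q := fine (normal_prob 0 1 ((fun x => x + delta q)%R @^-1` (B q))).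
  have mBd q : measurable ((fun x => x + delta q)%R @^-1` (B q)).
    by rewrite -[X in measurable X]setTI; exact: measurable_shift.
  have mE q : (m q)%:E = normal_prob 0 1 ((fun x => x + delta q)%R @^-1` (B q)).
    by rewrite /m fineK//; apply: fin_num_measure; exact: mBd.
  have in_rect (D : K -> set R) (w : K -> R) :
      \1_[set w | forall q, D q (w q)] w = (\prod_q \1_(D q) (w q))%R :> R.
    rewrite indicE; have [/set_mem h|h] := boolP (w \in [set w | forall q, D q (w q)]).
      by rewrite big1// => q _; rewrite indicE mem_set.
    have [q Hq] : exists q, ~ D q (w q).
      by apply/existsNP => h'; move: h; rewrite notin_setE.
    apply/esym/eqP/prodf_eq0.
    by exists q => //=; rewrite indicE memNset.
  have e1 : nu1 [set w | forall q, B q (w q)] = (c * \prod_q m q)%:E.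
    rewrite nu1E -(XV (g := fun q x => \1_(B q) (x + delta q)%R)).
    - rewrite integral_mkcond; apply: eq_integral => t _.
      by rewrite epatch_indic/= -EFinM -in_rect.
    - move=> q; apply: (measurableT_comp (measurable_indic (mB q))).
      exact: measurable_shift.
    - by move=> q x; rewrite indicE.
    - move=> q; rewrite mE.
      transitivity (\int[normal_prob 0 1]_x (\1_((fun x => x + delta q)%R @^-1` (B q)) x)%:E) => //.
      by rewrite integral_indic ?setIT//; exact: mBd.
  have e2 : nu2 [set w | forall q, B q (w q)] = (c * \prod_q m q)%:E.
    rewrite nu2E -(XV (g := fun q x => \1_(B q) x * tilt (delta q) x)%R).
    - rewrite integral_mkcond; apply: eq_integral => t _.
      rewrite epatch_indic/= -EFinM big_split/= -in_rect.
      by rewrite -mulrA; congr (_ * _)%:E; rewrite mulrC.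
    - move=> q; apply: measurable_funM; [exact: measurable_indic|exact: measurable_tilt].
    - by move=> q x; rewrite mulr_ge0 ?tilt_ge0// indicE.
    - by move=> q; rewrite mE normal_shift.
  by rewrite e1 e2 ltry.
apply: (@measure_unique _ R noise_space rectangles (fun=> setT)) => //.
- exact: rectangles_setI.
- move=> _; exists (fun=> setT); split => //.
  by apply/seteqP; split.
- by apply/seteqP; split => // w _; exists 0%N.
- by move=> _ [B [mB ->]]; exact: (rectE B mB).1.
- move=> _; have := (rectE (fun=> setT) (fun=> measurableT)).2.
  by congr (nu1 _ < _); apply/seteqP; split.
Qed.

End shifted_noise.

(** * Likelihood ratio and chi-square divergence of two parameters *)

Section likelihood_ratio.
Local Open Scope ereal_scope.
Context disp (T : measurableType disp) (R : realType) (P : probability T R).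
Variables (n d : nat) (p sigma : R) (A : edge n -> {RV P >-> bool})
  (W : edge n -> 'I_d -> 'I_d -> {RV P >-> R}).
Hypotheses (p_ge0 : (0 <= p)%R) (p_le1 : (p <= 1)%R) (sigma_gt0 : (0 < sigma)%R).
Hypothesis AW : sync_model p A W.

Notation K := (edge n * ('I_d * 'I_d))%type.
Notation data_space := (g_sigma_algebraType (@data_cylinders R n d)).
Notation noise_space := (g_sigma_algebraType (@rectangles R K)).

Definition signal (Z : 'I_n -> 'M[R]_d) (e : edge n) : 'M[R]_d :=
  (Z (edge_fst e) *m (Z (edge_snd e))^T)%R.

Definition sample (Z : 'I_n -> 'M[R]_d) (t : T) : data R n d :=
  observed sigma Z (fun e => A e t) (fun e k l => W e k l t).

Definition observed_noise (Z : 'I_n -> 'M[R]_d) (a : edge n -> bool) (v : K -> R) :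
  data R n d := observed sigma Z a (fun e k l => v (e, (k, l))).

Lemma measurable_observed_noise Z a :
  measurable_fun setT (observed_noise Z a : noise_space -> data_space).
Proof.
apply: (@measurability _ _ noise_space data_space setT _ (@data_cylinders R n d)) => //.
move=> _ [_ [e [k [l [B [mB ->]]]]] <-]; rewrite setTI.
case: (boolP (a e)) => ae; last first.
  rewrite (_ : _ @^-1` _ = set0)//; apply/seteqP; split => // v /= [M].
  by rewrite /observed_noise /observed (negbTE ae).
rewrite (_ : _ @^-1` _ =
  (fun v : noise_space => signal Z e k l + sigma * v (e, (k, l)))%R @^-1` B).
  rewrite -[X in measurable X]setTI.
  have mf : measurable_fun setT
      (fun v : noise_space => signal Z e k l + sigma * v (e, (k, l)))%R.
    apply: measurable_funD => //; apply: measurable_funM => //.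
    exact: measurable_coord.
  exact: mf.
apply/seteqP; split => v /=; rewrite /observed_noise /observed ae.
  by move=> [M [<-]]; rewrite !mxE.
move=> Bv; exists (signal Z e + sigma *: \matrix_(i, j) v (e, (i, j)))%R => //.
by rewrite !mxE; move: Bv; rewrite !mxE.
Qed.

Lemma measurable_sample Z : measurable_fun setT (sample Z : T -> data_space).
Proof.
apply: (@measurability _ _ T data_space setT _ (@data_cylinders R n d)) => //.
move=> _ [_ [e [k [l [B [mB ->]]]]] <-]; rewrite setTI.
rewrite (_ : _ @^-1` _ = ((A e : T -> bool) @^-1` [set true]) `&`
  ((fun t => signal Z e k l + sigma * W e k l t)%R @^-1` B)).
  apply: measurableI; rewrite -[X in measurable X]setTI.
    exact: (measurable_funP (A e)).
  have mf : measurable_fun setT (fun t => signal Z e k l + sigma * W e k l t)%R.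
    by apply: measurable_funD => //; apply: measurable_funM.
  exact: mf.
apply/seteqP; split => t /=; rewrite /sample /observed.
  by case: (A e t) => -[M] //= [<-]; rewrite !mxE.
move=> [-> Bt]; exists (signal Z e + sigma *: \matrix_(i, j) W e i j t)%R => //.
by rewrite !mxE; move: Bt; rewrite !mxE.
Qed.

Section pair.
Variables Z Z' : 'I_n -> 'M[R]_d.

(** The translation of the noise that turns data at [Z] into data at [Z']. It is 0 on unobserved
    edges, whose factor in the likelihood ratio is then 1. *)
Definition noise_shift (a : edge n -> bool) (q : K) : R :=
  (if a q.1 then (signal Z' q.1 - signal Z q.1) q.2.1 q.2.2 / sigma else 0)%R.

Lemma observed_noise_shift a v :
  observed_noise Z' a v = observed_noise Z a (fun q => v q + noise_shift a q)%R.
Proof.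
apply/funext => e; rewrite /observed_noise /observed.
case: (boolP (a e)) => // ae; congr Some; apply/matrixP => k l.
rewrite !mxE /noise_shift/= ae mulrDr !mxE; field.
by rewrite gt_eqF.
Qed.

(** The density of the law at [Z'] with respect to the law at [Z], evaluated at the sample drawn at
    [Z] and expressed through its noise. *)
Definition likelihood_ratio (t : T) : R :=
  (\prod_q tilt (noise_shift (fun e => A e t) q) (noise W q t))%R.

Lemma likelihood_ratio_ge0 t : (0 <= likelihood_ratio t)%R.
Proof. by apply: prodr_ge0 => q _; exact: tilt_ge0. Qed.

End pair.

Lemma edges_are_sum (h : (edge n -> bool) -> R) t :
  (\sum_(a : {ffun edge n -> bool}) edges_are A a t * h a = h (fun e => A e t))%R.
Proof.
rewrite (bigD1 [ffun e => A e t])//= big1 ?addr0.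
  rewrite /edges_are big1 ?mul1r; last by move=> e _; rewrite ffunE eqxx.
  by congr h; apply/funext => e; rewrite ffunE.
move=> a /eqP aA; apply/eqP; rewrite mulf_eq0; apply/orP; left.
have [e He] : exists e, A e t != a e.
  apply/existsP; rewrite -negb_forall; apply/forallP => h'; apply: aA.
  by apply/ffunP => e; rewrite ffunE; apply/esym/eqP.
by apply/prodf_eq0; exists e; rewrite // (negbTE He).
Qed.

Lemma integral_edges_split (h : (edge n -> bool) -> T -> R) :
  (forall a, measurable_fun setT (h a)) -> (forall a t, (0 <= h a t)%R) ->
  \int[P]_t (h (fun e => A e t) t)%:E =
  \sum_(a : {ffun edge n -> bool}) \int[P]_t (edges_are A a t * h a t)%:E.
Proof.
move=> mh h0; rewrite -ge0_integral_sum//.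
- apply: eq_integral => t _; rewrite sumEFin; congr EFin.
  by rewrite -(edges_are_sum (fun a => h a t)).
- move=> a; apply/measurable_EFinP; apply: measurable_funM => //.
  exact: measurable_edges_are.
- by move=> a t _; rewrite lee_fin mulr_ge0// edges_are_ge0.
Qed.

Section change_of_measure.
Variables Z Z' : 'I_n -> 'M[R]_d.

Let shifted_tilt (a : edge n -> bool) t : R :=
  (\prod_q tilt (noise_shift Z Z' a q) (noise W q t))%R.

Let measurable_shifted_tilt a : measurable_fun setT (shifted_tilt a).
Proof.
apply: measurable_prod => q _; apply: measurableT_comp => //.
exact: measurable_tilt.
Qed.

Let shifted_tilt_ge0 a t : (0 <= shifted_tilt a t)%R.
Proof. by apply: prodr_ge0 => q _; exact: tilt_ge0. Qed.

Lemma measurable_likelihood_ratio : measurable_fun setT (likelihood_ratio Z Z').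
Proof.
rewrite (_ : likelihood_ratio Z Z' =
  (fun t => \sum_(a : {ffun edge n -> bool}) edges_are A a t * shifted_tilt a t)%R).
  apply: measurable_sum => a; apply: measurable_funM => //.
  exact: measurable_edges_are.
apply/funext => t.
by rewrite (edges_are_sum (fun a => shifted_tilt a t)).
Qed.

Lemma integral_likelihood_ratio (psi : data_space -> R) :
  measurable_fun setT psi -> (forall y, (0 <= psi y)%R) ->
  \int[P]_t (psi (sample Z' t))%:E =
  \int[P]_t (psi (sample Z t) * likelihood_ratio Z Z' t)%:E.
Proof.
move=> mpsi psi0.
have mobs Z0 a : measurable_fun setT
    (fun t => psi (observed_noise Z0 a (fun q => noise W q t))).
  apply: (measurableT_comp mpsi).
  apply: (measurableT_comp (measurable_observed_noise Z0 a)).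
  by apply: measurable_to_noise => q; exact: measurable_noise.
(* For a fixed graph the data are a measurable function of the noise alone, so the Gaussian shift
   applies graph by graph. *)
transitivity (\sum_(a : {ffun edge n -> bool})
    \int[P]_t (edges_are A a t * psi (observed_noise Z' a (fun q => noise W q t)))%:E).
  by rewrite -(integral_edges_split
    (h := fun a t => psi (observed_noise Z' a (fun q => noise W q t)))).
rewrite (integral_edges_split
    (h := fun a t => psi (observed_noise Z a (fun q => noise W q t)) * shifted_tilt a t)%R);
  last 2 first.
- by move=> a; apply: measurable_funM.
- by move=> a t; rewrite mulr_ge0.
apply: eq_bigr => a _.
have := @shift_integral R _ _ T P (noise W) (edges_are A a)
  (\prod_e bernoulli_weight p (a e))%R (measurable_noise W) (measurable_edges_are A a)
  (edges_are_ge0 A a) (@model_integral_prod _ T R P n d p A W p_ge0 p_le1 AW a)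
  (noise_shift Z Z' a) (psi \o observed_noise Z a).
move=> H; transitivity (\int[P]_t (psi (observed_noise Z a
   (fun q => noise W q t + noise_shift Z Z' a q)%R) * edges_are A a t)%:E).
  by apply: eq_integral => t _; rewrite (observed_noise_shift Z) mulrC.
have mG : measurable_fun setT (psi \o observed_noise Z a : noise_space -> R).
  by apply: measurableT_comp => //; exact: measurable_observed_noise.
rewrite (H mG (fun w => psi0 _)).
by apply: eq_integral => t _; rewrite mulrCA.
Qed.

(** Closed form of the chi-square divergence of the law at [Z'] from the law at [Z]: an edge is seen
    with probability [p], its Gaussian shift contributes an exponential second moment, and
    independent edges multiply. *)
Definition chi2 : R := (\prod_e (1 - p + p * expR (
  (\sum_k \sum_l (signal Z' e - signal Z e) k l ^+ 2) / sigma ^+ 2)) - 1)%R.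

Lemma integral_likelihood_ratio_sqr :
  \int[P]_t (likelihood_ratio Z Z' t ^+ 2)%:E = (1 + chi2)%:E.
Proof.
rewrite (integral_edges_split (h := fun a t => shifted_tilt a t ^+ 2)%R); last 2 first.
- by move=> a; apply: measurable_funX.
- by move=> a t; rewrite sqr_ge0.
pose x e : R := ((\sum_k \sum_l (signal Z' e - signal Z e) k l ^+ 2) / sigma ^+ 2)%R.
pose m a q : R := expR (noise_shift Z Z' a q ^+ 2).
have H a : \int[P]_t (edges_are A a t * shifted_tilt a t ^+ 2)%:E =
    (\prod_e (bernoulli_weight p (a e) * expR ((a e)%:R * x e)))%:E.
  rewrite big_split/= (_ : (\prod_e expR _)%R = (\prod_q m a q)%R); last first.
    rewrite -(pair_bigA _ (fun e kl => m a (e, kl)))%R; apply: eq_bigr => e _.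
    rewrite -(pair_bigA _ (fun k l => m a (e, (k, l))))%R/=.
    rewrite /x mulr_suml mulr_sumr expR_sum; apply: eq_bigr => k _.
    rewrite mulr_suml mulr_sumr expR_sum; apply: eq_bigr => l _.
    rewrite /m /noise_shift/=; congr expR; case: (a e).
      by rewrite mul1r expr_div_n.
    by rewrite mul0r expr0n.
  rewrite -(@model_integral_prod _ T R P n d p A W p_ge0 p_le1 AW a
    (fun q x => tilt (noise_shift Z Z' a q) x ^+ 2)%R (m a)).
  - by apply: eq_integral => t _; rewrite /shifted_tilt prodrXl.
  - by move=> q; apply: measurable_funX; exact: measurable_tilt.
  - by move=> q y; exact: sqr_ge0.
  - move=> q; under eq_integral do rewrite tilt_sqr EFinM.
    rewrite ge0_integralZl ?lee_fin ?expR_ge0//.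
    + by rewrite integral_tilt mule1.
    + by apply/measurable_EFinP; exact: measurable_tilt.
    + by move=> y _; rewrite lee_fin tilt_ge0.
under eq_bigr do rewrite H.
rewrite sumEFin; congr EFin; rewrite /chi2 addrCA subrr addr0.
rewrite -(bigA_distr_bigA (fun e b => bernoulli_weight p b * expR (b%:R * x e)))%R/=.
apply: eq_bigr => e _.
rewrite big_bool/= /bernoulli_weight mul1r mul0r expR0 mulr1.
by rewrite addrC.
Qed.

End change_of_measure.

End likelihood_ratio.

(** * Means of bounded statistics and the change of measure *)

Section bounded_integrals.
Context disp (T : measurableType disp) (R : realType) (P : probability T R).

Lemma bounded_integrable (X : T -> R) (B : R) :
  measurable_fun setT X -> (forall t, `|X t| <= B) ->
  P.-integrable setT (EFin \o X).
Proof.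
move=> mX XB; apply: measurable_bounded_integrable => //.
  by rewrite (le_lt_trans (probability_le1 _ measurableT))// ltry.
exists B; split; first exact: num_real.
by move=> M BM t _ /=; exact: le_trans (XB t) (ltW BM).
Qed.

Lemma ge0_integrable (X : T -> R) (c : R) :
  measurable_fun setT X -> (forall t, 0 <= X t) ->
  (\int[P]_t (X t)%:E = c%:E)%E -> P.-integrable setT (EFin \o X).
Proof.
move=> mX X0 Xc; apply/integrableP; split; first exact/measurable_EFinP.
under eq_integral do rewrite /= ger0_norm//.
by rewrite Xc ltry.
Qed.

Lemma Rintegral_prob_cst (c : R) : \int[P]_t c = c.
Proof.
rewrite Rintegral_cst// -[RHS]mulr1; congr (_ * _).
exact: (congr1 fine (probability_setT P)).
Qed.

End bounded_integrals.

Section key_inequality.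
Context disp (T : measurableType disp) (R : realType) (P : probability T R).
Variables (n d : nat) (p sigma : R) (A : edge n -> {RV P >-> bool})
  (W : edge n -> 'I_d -> 'I_d -> {RV P >-> R}).
Hypotheses (p_ge0 : 0 <= p) (p_le1 : p <= 1) (sigma_gt0 : 0 < sigma).
Hypothesis AW : sync_model p A W.

Notation data_space := (g_sigma_algebraType (@data_cylinders R n d)).
Notation sample := (sample sigma A W).

Definition mean (Z : 'I_n -> 'M[R]_d) (psi : data R n d -> R) : R :=
  \int[P]_t psi (sample Z t).

Definition admissible (psi : data R n d -> R) : Prop :=
  measurable_fun setT (psi : data_space -> R) /\ exists B, forall y, `|psi y| <= B.

Lemma admissible_cst c : admissible (cst c).
Proof. by split=> //; exists `|c|. Qed.

Lemma admissibleD f g : admissible f -> admissible g -> admissible (fun y => f y + g y).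
Proof.
move=> [mf [B fB]] [mg [C gC]]; split; first exact: measurable_funD.
by exists (B + C) => y; rewrite (le_trans (ler_normD _ _))// lerD.
Qed.

Lemma admissibleM f g : admissible f -> admissible g -> admissible (fun y => f y * g y).
Proof.
move=> [mf [B fB]] [mg [C gC]]; split; first exact: measurable_funM.
by exists (B * C) => y; rewrite normrM ler_pM.
Qed.

Lemma admissibleZ c f : admissible f -> admissible (fun y => c * f y).
Proof. by move=> hf; apply: admissibleM => //; exact: admissible_cst. Qed.

Lemma admissibleN f : admissible f -> admissible (fun y => - f y).
Proof.
move=> hf; rewrite (_ : (fun y => - f y) = (fun y => -1 * f y)); first exact: admissibleZ.
by apply/funext => y; rewrite mulN1r.
Qed.

Lemma admissible_sum (I : Type) (s : seq I) (Q : pred I) (f : I -> data R n d -> R) :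
  (forall i, Q i -> admissible (f i)) -> admissible (fun y => \sum_(i <- s | Q i) f i y).
Proof.
move=> hf; elim: s => [|i s IH].
  by under eq_fun do rewrite big_nil; exact: admissible_cst.
under eq_fun do rewrite big_cons; case: (boolP (Q i)) => // Qi.
by apply: admissibleD => //; exact: hf.
Qed.

Section mean_theory.
Variable Z : 'I_n -> 'M[R]_d.

Lemma admissible_integrable f : admissible f ->
  P.-integrable setT (EFin \o (f \o sample Z)).
Proof.
move=> [mf [B fB]]; apply: (@bounded_integrable _ _ _ _ _ B); last by move=> t; exact: fB.
by apply: (measurableT_comp mf); exact: measurable_sample.
Qed.

Lemma mean_cst c : mean Z (cst c) = c.
Proof. exact: Rintegral_prob_cst. Qed.

Lemma meanD f g : admissible f -> admissible g ->
  mean Z (fun y => f y + g y) = mean Z f + mean Z g.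
Proof.
move=> hf hg; exact: (RintegralD measurableT (admissible_integrable hf) (admissible_integrable hg)).
Qed.

Lemma meanZ c f : admissible f -> mean Z (fun y => c * f y) = c * mean Z f.
Proof. by move=> hf; exact: (RintegralZl c measurableT (admissible_integrable hf)). Qed.

Lemma mean_le f g : admissible f -> admissible g -> (forall y, f y <= g y) ->
  mean Z f <= mean Z g.
Proof.
move=> hf hg fg.
apply: (le_Rintegral measurableT (admissible_integrable hf) (admissible_integrable hg)).
by move=> t _; exact: fg.
Qed.

Lemma meanB f g : admissible f -> admissible g ->
  mean Z (fun y => f y - g y) = mean Z f - mean Z g.
Proof.
move=> hf hg; exact: (RintegralB measurableT (admissible_integrable hf) (admissible_integrable hg)).
Qed.

Lemma mean_sum (I : Type) (s : seq I) (Q : pred I) (f : I -> data R n d -> R) :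
  (forall i, Q i -> admissible (f i)) ->
  mean Z (fun y => \sum_(i <- s | Q i) f i y) = \sum_(i <- s | Q i) mean Z (f i).
Proof.
move=> hf; elim: s => [|i s IH].
  by rewrite big_nil -[RHS](mean_cst 0); congr (mean Z _); apply/funext => y; rewrite big_nil.
rewrite big_cons -IH; case: ifP => Qi.
  rewrite -meanD; [|exact: hf|exact: admissible_sum].
  by congr (mean Z _); apply/funext => y; rewrite big_cons Qi.
by congr (mean Z _); apply/funext => y; rewrite big_cons Qi.
Qed.

Lemma EFin_mean f : admissible f ->
  ((mean Z f)%:E = \int[P]_t (f (sample Z t))%:E)%E.
Proof.
move=> hf; rewrite /mean /Rintegral fineK//.
exact: (integrable_fin_num measurableT (admissible_integrable hf)).
Qed.

End mean_theory.

(** With [L] the likelihood ratio, the left side is the mean at [Z] of [psi * (L - 1)]. AM-GM bounds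
    this product by half of [lam * psi^2 + (L - 1)^2 / lam], and [(L - 1)^2] has mean [chi2]. *)
Lemma mean_change (Z Z' : 'I_n -> 'M[R]_d) (psi : data R n d -> R) (lam : R) :
  admissible psi -> 0 < lam ->
  mean Z' psi - mean Z psi <=
  (lam * mean Z (fun y => psi y ^+ 2) + chi2 p sigma Z Z' / lam) / 2.
Proof.
move=> hpsi lam_gt0; have [mpsi [B psiB]] := hpsi.
pose L := likelihood_ratio sigma A W Z Z'.
have mL : measurable_fun setT L by exact: measurable_likelihood_ratio.
have L0 t : 0 <= L t by exact: likelihood_ratio_ge0.
have LE f : measurable_fun setT (f : data_space -> R) -> (forall y, 0 <= f y) ->
    (\int[P]_t (f (sample Z' t))%:E = \int[P]_t (f (sample Z t) * L t)%:E)%E.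
  by move=> mf f0; exact: (integral_likelihood_ratio p_ge0 p_le1 sigma_gt0 AW).
have L1 : (\int[P]_t (L t)%:E = 1%:E)%E.
  transitivity (\int[P]_t (cst 1 (sample Z t) * L t)%:E)%E.
    by apply: eq_integral => t _; rewrite mul1r.
  rewrite -LE//; transitivity (\int[P]_t (cst 1 t))%E => //.
  by rewrite integral_cst// mul1e; exact: probability_setT.
have L2 : (\int[P]_t (L t ^+ 2)%:E = (1 + chi2 p sigma Z Z')%:E)%E.
  exact: (integral_likelihood_ratio_sqr sigma p_ge0 p_le1 AW).
have iL : P.-integrable setT (EFin \o L) by exact: ge0_integrable L1.
have iL2 : P.-integrable setT (EFin \o (fun t => L t ^+ 2)).
  by apply: (ge0_integrable _ _ L2) => [|t]; [exact: measurable_funX|exact: sqr_ge0].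
(* The change of measure is stated for non-negative statistics, so [psi] is raised by its bound [B],
   which cancels at the end. *)
have hpsiB : admissible (fun y => psi y + B).
  by apply: admissibleD => //; exact: admissible_cst.
have psiB0 y : 0 <= psi y + B by have := psiB y; rewrite ler_norml => /andP[]; lra.
have hpsi2 : admissible (fun y => psi y ^+ 2).
  by under eq_fun do rewrite expr2; exact: admissibleM.
pose phi t := psi (sample Z t).
have iphi : P.-integrable setT (EFin \o phi) := admissible_integrable Z hpsi.
have iphi2 : P.-integrable setT (EFin \o (fun t => phi t ^+ 2)) :=
  admissible_integrable Z hpsi2.
have iphiL : P.-integrable setT (EFin \o (fun t => (phi t + B) * L t)).
  apply: (@ge0_integrable _ _ _ _ _ (mean Z' (fun y => psi y + B))).
  - apply: measurable_funM => //.
    exact: (measurableT_comp hpsiB.1 (measurable_sample sigma A W Z)).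
  - by move=> t; apply: mulr_ge0 => //; exact: psiB0.
  - by rewrite -(LE (fun y => psi y + B) hpsiB.1)// EFin_mean.
have icst c : P.-integrable setT (EFin \o (fun _ : T => c)).
  by apply: (@bounded_integrable _ _ _ _ _ `|c|).
have iZ c X : P.-integrable setT (EFin \o X) ->
    P.-integrable setT (EFin \o (fun t => c * X t)).
  by move=> iX; exact: (integrableZl measurableT c iX).
have iD X Y : P.-integrable setT (EFin \o X) -> P.-integrable setT (EFin \o Y) ->
    P.-integrable setT (EFin \o (fun t => X t + Y t)).
  by move=> iX iY; exact: (integrableD measurableT iX iY).
have e1 : mean Z' psi + B = \int[P]_t ((phi t + B) * L t).
  rewrite -[X in _ + X](mean_cst Z') -meanD//; last exact: admissible_cst.
  by rewrite /mean /Rintegral (LE (fun y => psi y + B) hpsiB.1).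
have i1 := iD _ _ (iZ (B - lam^-1) _ iL) (icst (2 * lam)^-1).
have i2 := iD _ _ (iZ (2 * lam)^-1 _ iL2) i1.
have i3 := iD _ _ (iZ (lam / 2) _ iphi2) i2.
(* The integrands differ by the square [(lam * phi - (L - 1))^2 / (2 * lam)]; the larger one is
   expanded into terms with known integrals. *)
have e2 : \int[P]_t ((phi t + B) * L t) <=
    \int[P]_t (phi t + (lam / 2 * phi t ^+ 2 + ((2 * lam)^-1 * L t ^+ 2 +
      ((B - lam^-1) * L t + (2 * lam)^-1)))).
  apply: le_Rintegral => //; first exact: iD.
  move=> t _; rewrite -subr_ge0.
  rewrite (_ : _ - _ = (2 * lam)^-1 * (lam * phi t - (L t - 1)) ^+ 2).
    by rewrite mulr_ge0 ?sqr_ge0// invr_ge0 mulr_ge0// ltW.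
  by field; rewrite gt_eqF.
move: e2; rewrite -e1.
rewrite RintegralD// RintegralD//; last exact: iZ.
rewrite RintegralD//; last exact: iZ.
rewrite RintegralD//; last exact: iZ.
rewrite !RintegralZl// Rintegral_prob_cst.
rewrite -/(mean Z psi) -/(mean Z (fun y => psi y ^+ 2)).
rewrite {1 2}/Rintegral L1 L2/= => e2.
rewrite -subr_ge0.
rewrite (_ : _ - _ = mean Z psi +
  (lam / 2 * mean Z (fun y : data R n d => psi y ^+ 2) +
   ((2 * lam)^-1 * (1 + chi2 p sigma Z Z') + ((B - lam^-1) * 1 + (2 * lam)^-1))) - (mean Z' psi + B)).
  by rewrite subr_ge0.
by field; rewrite gt_eqF.
Qed.

End key_inequality.

(** * Almost invariant nets *)

Section hall.
Context (X Y : finType) (r : X -> Y -> bool) (y0 : Y).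
Local Open Scope set_scope.

Definition neighbours (B : {set Y}) (S : {set X}) : {set Y} :=
  [set y in B | [exists x in S, r x y]].

(** The Halmos-Vaughan induction. A proper nonempty [S] without surplus of neighbours is matched
    separately; for the rest, Hall's condition at [U] follows from that at [U :|: S]. Both cases
    recurse on smaller [A] and [B], whence the relative form; [y0] is a default value. *)
Lemma hall_in (k : nat) (A : {set X}) (B : {set Y}) : (#|A| <= k)%N ->
  (forall S : {set X}, S \subset A -> (#|S| <= #|neighbours B S|)%N) ->
  exists f : X -> Y, {in A &, injective f} /\
    forall x, x \in A -> r x (f x) && (f x \in B).
Proof.
elim: k A B => [|k IH] A B Ak hall.
  exists (fun=> y0); move: Ak; rewrite leqn0 cards_eq0 => /eqP ->.
  by split => x; rewrite inE.
have [->|[a aA]] := finset.set_0Vmem A.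
  by exists (fun=> y0); split => x; rewrite inE.
have [/existsP[S /and4P[S0 SA nSA critS]]|noncrit] := boolP [exists S : {set X},
    [&& S != finset.set0, S \subset A, S != A & (#|neighbours B S| <= #|S|)%N]].
  have ltSA : (#|S| < #|A|)%N by rewrite proper_card// finset.properEneq nSA.
  have [f1 [inj1 f1P]] : exists f : X -> Y, {in S &, injective f} /\
      forall x, x \in S -> r x (f x) && (f x \in B).
    apply: IH; first by rewrite -ltnS (leq_trans ltSA).
    by move=> U US; apply: hall; exact: fintype.subset_trans SA.
  have [f2 [inj2 f2P]] : exists f : X -> Y, {in A :\: S &, injective f} /\
      forall x, x \in A :\: S -> r x (f x) && (f x \in B :\: neighbours B S).
    apply: IH.
      rewrite -ltnS (leq_trans _ Ak)// proper_card// finset.properEneq finset.subsetDl andbT.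
      apply: contra S0 => /eqP AS; rewrite -finset.subset0; apply/fintype.subsetP => x xS.
      by move: (fintype.subsetP SA x xS); rewrite -AS inE xS.
    move=> U UAS.
    have := hall (U :|: S); rewrite finset.subUset SA andbT.
    rewrite (fintype.subset_trans UAS (finset.subsetDl _ _)) => /(_ isT).
    rewrite finset.cardsU finset.disjoint_setI0 ?finset.cards0 ?subn0; last first.
      rewrite finset.disjoints_subset; apply/fintype.subsetP => x /(fintype.subsetP UAS).
      by rewrite !inE => /andP[].
    have : (#|neighbours B (U :|: S)| <=
        #|neighbours (B :\: neighbours B S) U| + #|neighbours B S|)%N.
      rewrite (leq_trans _ (leq_card_setU _ _))// subset_leq_card//.
      apply/fintype.subsetP => y; rewrite !inE => /andP[yB /existsP[x]].
      rewrite inE yB/= => /andP[/orP[xU|xS] rxy]; last first.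
        by apply/orP; right; apply/existsP; exists x; rewrite xS.
      case: [exists x in S, r x y] => //=; rewrite ?orbT// orbF.
      by apply/existsP; exists x; rewrite xU.
    by move=> h1 h2; lia.
  exists (fun x => if x \in S then f1 x else f2 x); split; last first.
    move=> x xA; case: ifP => xS; first exact: f1P.
    by have := f2P x; rewrite !inE xS xA => /(_ isT) /and3P[-> _ ->].
  have sep x x' : x \in S -> x' \in A -> x' \notin S -> f1 x != f2 x'.
    move=> xS x'A x'S; apply/eqP => e.
    have := f2P x'; rewrite inE x'S x'A => /(_ isT) /andP[_].
    rewrite -e !inE => /andP[/negP + f1B]; apply; rewrite f1B/=.
    by apply/existsP; exists x; rewrite xS; have /andP[] := f1P _ xS.
  move=> x x' xA x'A; case: ifP => xS; case: ifP => x'S e.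
  - exact: inj1.
  - by have := sep x x' xS x'A (negbT x'S); rewrite e eqxx.
  - by have := sep x' x x'S xA (negbT xS); rewrite e eqxx.
  - by apply: inj2 => //; rewrite inE ?xS ?x'S.
(* Every proper nonempty subset now has a neighbour to spare, so [a] may take any neighbour [y]. *)
have [y yNa] : exists y, y \in neighbours B [set a].
  apply/finset.set0Pn; rewrite -card_gt0 (leq_trans _ (hall [set a] _))//.
    by rewrite cards1.
  by rewrite finset.sub1set.
have /andP[yB ray] : (y \in B) && r a y.
  move: yNa; rewrite inE => /andP[-> /existsP[x]].
  by rewrite inE => /andP[/eqP ->].
have [f [injf fP]] : exists f : X -> Y, {in A :\ a &, injective f} /\
    forall x, x \in A :\ a -> r x (f x) && (f x \in B :\ y).
  apply: IH; first by rewrite -ltnS (leq_trans _ Ak)// (cardsD1 a A) aA.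
  move=> S SAa; have [->|S0] := eqVneq S finset.set0; first by rewrite finset.cards0.
  have SA : S \subset A := fintype.subset_trans SAa (finset.subD1set _ _).
  have : (#|S| < #|neighbours B S|)%N.
    rewrite ltnNge; apply: contra noncrit => crit.
    apply/existsP; exists S; rewrite S0 SA crit andbT/=.
    by apply: contraTneq SAa => ->; rewrite finset.subsetD1 aA andbF.
  have : (#|neighbours B S| <= #|neighbours (B :\ y) S| + 1)%N.
    rewrite -(cards1 y) (leq_trans _ (leq_card_setU _ _))// subset_leq_card//.
    by apply/fintype.subsetP => z; rewrite !inE; case: (z == y); rewrite ?orbT ?orbF.
  by move=> h1 h2; lia.
exists (fun x => if x == a then y else f x); split; last first.
  move=> x xA; case: eqP => [->|/eqP xa]; first by rewrite ray.
  by have := fP x; rewrite !inE xa xA => /(_ isT) /and3P[-> _ ->].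
have sep x : x \in A -> x != a -> f x != y.
  by move=> xA xa; have := fP x; rewrite !inE xa xA => /(_ isT) /and3P[].
move=> x x' xA x'A; case: eqP => [->|/eqP xa]; case: eqP => [->//|/eqP x'a] e.
- by have := sep x' x'A x'a; rewrite e eqxx.
- by have := sep x xA xa; rewrite e eqxx.
- by apply: injf; rewrite // !inE ?xa ?x'a.
Qed.

Lemma hall_marriage :
  (forall S : {set X}, (#|S| <= #|[set y | [exists x in S, r x y]]|)%N) ->
  exists f : X -> Y, injective f /\ forall x, r x (f x).
Proof.
move=> hall; have [|f [injf fP]] := @hall_in #|[set: X]| [set: X] [set: Y] (leqnn _).
  move=> S _; rewrite (leq_trans (hall S))//; apply: subset_leq_card.
  by apply/fintype.subsetP => y; rewrite !inE.
exists f; split; first by move=> x x'; apply: injf; rewrite inE.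
by move=> x; have /andP[] := fP x (finset.in_setT x).
Qed.

End hall.

(** * Squared Frobenius norm and orthogonal matrices *)

Section square_norm.
Context (R : realType).
Implicit Types (m n d : nat).

Definition sqnorm m n (M : 'M[R]_(m, n)) : R := \sum_i \sum_j M i j ^+ 2.

Lemma sqnorm_ge0 m n (M : 'M[R]_(m, n)) : 0 <= sqnorm M.
Proof. by do 2 apply: sumr_ge0 => ? _; exact: sqr_ge0. Qed.

Lemma frobenius_norm_sqr m n (M : 'M[R]_(m, n)) : frobenius_norm M ^+ 2 = sqnorm M.
Proof. by rewrite /frobenius_norm sqr_sqrtr// sqnorm_ge0. Qed.

Lemma sqnormE m n (M : 'M[R]_(m, n)) : sqnorm M = \tr (M *m M^T).
Proof.
apply: eq_bigr => i _; rewrite mxE; apply: eq_bigr => j _.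
by rewrite mxE expr2.
Qed.

Lemma sqnorm_trmx m n (M : 'M[R]_(m, n)) : sqnorm M^T = sqnorm M.
Proof.
rewrite /sqnorm exchange_big; apply: eq_bigr => i _; apply: eq_bigr => j _.
by rewrite mxE.
Qed.

Lemma sqnormN m n (M : 'M[R]_(m, n)) : sqnorm (- M) = sqnorm M.
Proof. by apply: eq_bigr => i _; apply: eq_bigr => j _; rewrite mxE sqrrN. Qed.

Lemma sqnormD_le m n (M N : 'M[R]_(m, n)) :
  sqnorm (M + N) <= 2 * sqnorm M + 2 * sqnorm N.
Proof.
rewrite /sqnorm !mulr_sumr -big_split/=; apply: ler_sum => i _.
rewrite !mulr_sumr -big_split/=; apply: ler_sum => j _.
by rewrite mxE; have := sqr_ge0 (M i j - N i j); nra.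
Qed.

Lemma sqnorm_entry m n (M : 'M[R]_(m, n)) i j : M i j ^+ 2 <= sqnorm M.
Proof.
rewrite /sqnorm (bigD1 i)//= (bigD1 j)//= -addrA lerDl addr_ge0//.
  by apply: sumr_ge0 => ? _; exact: sqr_ge0.
by do 2 apply: sumr_ge0 => ? _; exact: sqr_ge0.
Qed.

Lemma sqnorm_mulmx_orthogonal m d (M : 'M[R]_(m, d)) (U : 'M[R]_d) :
  orthogonal_group U -> sqnorm (M *m U) = sqnorm M.
Proof.
by move=> [UU _]; rewrite !sqnormE trmx_mul mulmxA -(mulmxA M) UU mulmx1.
Qed.

Lemma orthogonal_trmx d (U : 'M[R]_d) : orthogonal_group U -> orthogonal_group U^T.
Proof. by move=> [h1 h2]; split; rewrite trmxK. Qed.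

Lemma orthogonal_mulmx d (U V : 'M[R]_d) :
  orthogonal_group U -> orthogonal_group V -> orthogonal_group (U *m V).
Proof.
move=> [U1 U2] [V1 V2]; split; rewrite trmx_mul mulmxA.
  by rewrite -(mulmxA U) V1 mulmx1.
by rewrite -(mulmxA V^T) U2 mulmx1.
Qed.

Lemma orthogonal1 d : orthogonal_group (1%:M : 'M[R]_d).
Proof. by split; rewrite trmx1 mulmx1. Qed.

Lemma sqnorm_orthogonal_mulmx d m (U : 'M[R]_d) (M : 'M[R]_(d, m)) :
  orthogonal_group U -> sqnorm (U *m M) = sqnorm M.
Proof.
move=> /orthogonal_trmx oU.
by rewrite -sqnorm_trmx trmx_mul sqnorm_mulmx_orthogonal// sqnorm_trmx.
Qed.

Lemma orthogonal_entry d (U : 'M[R]_d) i j : orthogonal_group U -> U i j ^+ 2 <= 1.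
Proof.
move=> [UU _]; have := congr1 (fun M : 'M[R]_d => M i i) UU.
rewrite !mxE eqxx => h; rewrite -[leRHS]/(true%:R) -h (bigD1 j)//= !mxE -expr2 lerDl.
by apply: sumr_ge0 => k _; rewrite mxE -expr2 sqr_ge0.
Qed.

Lemma sqnorm_sub_orthogonal d (U V : 'M[R]_d) :
  orthogonal_group U -> orthogonal_group V ->
  sqnorm (U - V) = 2 * (d%:R - \tr (V^T *m U)).
Proof.
move=> [U1 U2] [V1 V2]; rewrite sqnormE linearB/= mulmxBl !mulmxBr U1 V1.
rewrite !linearB/= mxtrace1.
have -> : \tr (U *m V^T) = \tr (V^T *m U) by rewrite mxtrace_mulC.
have -> : \tr (V *m U^T) = \tr (V^T *m U).
  by rewrite -mxtrace_tr trmx_mul trmxK mxtrace_mulC.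
ring.
Qed.

(* The two sides differ by twice the squared norm of the sum of the [H i]. *)
Lemma pairwise_sqnorm_le m d n (H : 'I_n -> 'M[R]_(m, d)) :
  \sum_i \sum_j sqnorm (H i - H j) <= 2 * n%:R * \sum_i sqnorm (H i).
Proof.
have scal (h : 'I_n -> R) :
    \sum_i \sum_j (h i - h j) ^+ 2 <= 2 * n%:R * \sum_i h i ^+ 2.
  have -> : \sum_i \sum_j (h i - h j) ^+ 2 =
      2 * n%:R * \sum_i h i ^+ 2 - 2 * (\sum_i h i) ^+ 2.
    transitivity (\sum_i (n%:R * h i ^+ 2 + \sum_j h j ^+ 2 - 2 * h i * \sum_j h j)).
      apply: eq_bigr => i _.
      transitivity (\sum_j (h i ^+ 2 + h j ^+ 2 - 2 * h i * h j)).
        by apply: eq_bigr => j _; ring.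
      by rewrite !big_split/= sumr_const card_ord sumrN mulr_sumr (mulr_natl _ n).
    rewrite !big_split/= sumr_const card_ord -(mulr_natl _ n) sumrN -!mulr_sumr.
    by rewrite -mulr_suml -mulr_sumr; ring.
  by rewrite gerDl oppr_le0 mulr_ge0// sqr_ge0.
rewrite /sqnorm.
have -> : \sum_i \sum_j \sum_k \sum_l (H i - H j) k l ^+ 2 =
    \sum_k \sum_l \sum_i \sum_j (H i k l - H j k l) ^+ 2.
  under eq_bigr do rewrite exchange_big/=.
  rewrite exchange_big/=; apply: eq_bigr => k _.
  under eq_bigr do rewrite exchange_big/=.
  rewrite exchange_big/=; apply: eq_bigr => l _.
  apply: eq_bigr => i _; apply: eq_bigr => j _.
  by rewrite !mxE.
rewrite [in leRHS]exchange_big/= mulr_sumr; apply: ler_sum => k _.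
rewrite [in leRHS]exchange_big/= mulr_sumr; apply: ler_sum => l _.
exact: scal.
Qed.

End square_norm.

(** * Eliminating the global rotation from the loss *)

Section loss.
Context (R : realType) (n d : nat).
Hypothesis n_gt0 : (0 < n)%N.

(* Invariant under [Zhat i |-> Zhat i *m B] with [B] orthogonal, so the infimum
   over global rotations disappears. *)
Definition pair_error (Zhat Z : 'I_n -> 'M[R]_d) (i j : 'I_n) : R :=
  sqnorm (Zhat i *m (Zhat j)^T - Z i *m (Z j)^T).

Lemma pair_errorE (Zhat Z : 'I_n -> 'M[R]_d) i j :
  parameter_space Zhat -> parameter_space Z ->
  pair_error Zhat Z i j =
  sqnorm ((Z i)^T *m Zhat i - (Z j)^T *m Zhat j).
Proof.
move=> hZhat hZ; have [Zi1 Zi2] := hZ i; have [Zj1 Zj2] := hZ j.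
have [Hj1 Hj2] := hZhat j.
rewrite /pair_error -(sqnorm_orthogonal_mulmx _ (orthogonal_trmx (hZ i))).
rewrite -(sqnorm_mulmx_orthogonal _ (hZ j)) -(sqnorm_mulmx_orthogonal _
  (orthogonal_mulmx (orthogonal_trmx (hZ j)) (hZhat j))).
congr sqnorm; rewrite mulmxBr !mulmxBl.
rewrite !mulmxA Zi2 mul1mx Zj2 mul1mx -(mulmxA _ (Z j) (Z j)^T) Zj1 mulmx1.
by rewrite -(mulmxA _ (Zhat j)^T) Hj2 mulmx1.
Qed.

(** Put [H i = (Z i)^T *m Zhat i - B]. The squared norms of the [H i] sum to [n] times the objective
    at [B], while [H i - H j] is free of [B] and has the norm of the pair error;
    [pairwise_sqnorm_le] compares them for each [B]. *)
Lemma sync_loss_ge (Zhat Z : 'I_n -> 'M[R]_d) :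
  parameter_space Zhat -> parameter_space Z ->
  (2 * n%:R ^+ 2)^-1 * \sum_i \sum_j pair_error Zhat Z i j <= sync_loss Zhat Z.
Proof.
move=> hZhat hZ; rewrite /sync_loss; apply: lb_le_inf.
  by eexists; exists 1%:M; first exact: orthogonal1.
move=> _ [B oB <-].
have -> : \sum_i frobenius_norm (Zhat i - Z i *m B) ^+ 2 =
    \sum_i sqnorm ((Z i)^T *m Zhat i - B).
  apply: eq_bigr => i _; rewrite frobenius_norm_sqr.
  rewrite -(sqnorm_orthogonal_mulmx _ (orthogonal_trmx (hZ i))).
  by rewrite mulmxBr mulmxA (hZ i).2 mul1mx.
have := pairwise_sqnorm_le (fun i => (Z i)^T *m Zhat i - B).
under eq_bigr do under eq_bigr do rewrite opprB addrA subrK.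
under eq_bigr do under eq_bigr do rewrite -pair_errorE//.
move=> h; have n0 : 0 < n%:R :> R by rewrite ltr0n.
rewrite ler_pdivrMl ?mulr_gt0 ?exprn_gt0//.
apply: (le_trans h); rewrite le_eqVlt; apply/orP; left; apply/eqP.
by field; rewrite gt_eqF.
Qed.

End loss.

(** * Nets of the parameter space *)

Section nets.
Context (R : realType) (n d : nat).
Notation params := ('I_n -> 'M[R]_d).
Implicit Types (Z g : params).

Definition sqdist Z Z' : R := \sum_i sqnorm (Z i - Z' i).

Definition translate Z g : params := fun i => Z i *m g i.

Lemma translate_in Z g :
  parameter_space Z -> parameter_space g -> parameter_space (translate Z g).
Proof. by move=> hZ hg i; exact: orthogonal_mulmx. Qed.

Lemma sqdistC Z Z' : sqdist Z Z' = sqdist Z' Z.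
Proof. by apply: eq_bigr => i _; rewrite -sqnormN opprB. Qed.

Lemma sqnorm_le_sqdist Z Z' i : sqnorm (Z' i - Z i) <= sqdist Z Z'.
Proof.
rewrite sqdistC /sqdist (bigD1 i)//= lerDl.
by apply: sumr_ge0 => j _; exact: sqnorm_ge0.
Qed.

Lemma sqdist_trans Z Z' Z'' :
  sqdist Z Z'' <= 2 * sqdist Z Z' + 2 * sqdist Z' Z''.
Proof.
rewrite /sqdist !mulr_sumr -big_split/=; apply: ler_sum => i _.
by rewrite -[Z i - Z'' i](subrKA (Z' i)) sqnormD_le.
Qed.

Lemma sqdist_translate Z Z' g : parameter_space g ->
  sqdist (translate Z g) (translate Z' g) = sqdist Z Z'.
Proof.
move=> hg; apply: eq_bigr => i _.
by rewrite -mulmxBl sqnorm_mulmx_orthogonal.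
Qed.

Definition is_net (e : R) (I : finType) (N : I -> params) : Prop :=
  (forall x, parameter_space (N x)) /\
  forall Z, parameter_space Z -> exists x, sqdist Z (N x) <= e.

(** Entries of orthogonal matrices lie between -1 and 1. Cut this range into cells of side [1 / M]
    and keep one parameter per occupied cell. *)
Lemma finite_net (e : R) : 0 < e -> exists (I : finType) (N : I -> params), is_net e N.
Proof.
move=> e0.
pose c : R := n%:R * (d%:R * d%:R).
have c0 : 0 <= c by rewrite !mulr_ge0.
pose M := (Num.truncn (c / e)).+1.
have M0 : 0 < M%:R :> R by rewrite ltr0n.
have cM : c / M%:R ^+ 2 <= e.
  rewrite ler_pdivrMr ?exprn_gt0// mulrC -ler_pdivrMr//.
  have h : c / e < M%:R by exact: truncnS_gt.
  rewrite (le_trans (ltW h))// expr2.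
  by apply: ler_peMl; [exact: ltW|rewrite ler1n].
(* [(x + 1) * M] ranges over the closed interval from 0 to [2 * M], so its integer part takes
   [2 * M + 1] values. *)
pose grid : finType := {ffun 'I_n * ('I_d * 'I_d) -> 'I_(2 * M).+1}.
pose cell Z : grid :=
  [ffun q => inord (Num.truncn ((Z q.1 q.2.1 q.2.2 + 1) * M%:R))].
(* Unoccupied cells are sent to the identity, so that all values of [rep] are parameters. *)
pose rep (b : grid) : params :=
  if pselect (exists Z, parameter_space Z /\ cell Z = b) is left h
  then projT1 (cid h) else fun=> 1%:M.
exists grid, rep; split.
  move=> b; rewrite /rep; case: pselect => h; last by move=> i; exact: orthogonal1.
  by case: (cid h) => Z [].
move=> Z hZ; exists (cell Z); rewrite /rep; case: pselect => [h|[]]; last by exists Z.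
case: (cid h) => Z' /= [hZ' ZZ'].
suff close i k l : (Z i k l - Z' i k l) ^+ 2 <= (M%:R ^+ 2)^-1.
  apply: (le_trans _ cM).
  have -> : c / M%:R ^+ 2 = \sum_(i < n) \sum_(k < d) \sum_(l < d) (M%:R ^+ 2)^-1.
    by rewrite !sumr_const !card_ord /c -!mulrA !mulr_natl.
  by do 3 (apply: ler_sum => ? _); rewrite !mxE.
have bnd Z0 : parameter_space Z0 -> 0 <= (Z0 i k l + 1) * M%:R <= (2 * M)%:R.
  move=> /(_ i)/(orthogonal_entry k l) h0.
  have h1 : -1 <= Z0 i k l by nra.
  have h2 : Z0 i k l <= 1 by nra.
  rewrite natrM ler_pM2r//; apply/andP; split; last lra.
  by apply: mulr_ge0; [lra|exact: ltW].
have truncE Z0 : parameter_space Z0 ->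
    (cell Z0 (i, (k, l)) : nat) = Num.truncn ((Z0 i k l + 1) * M%:R).
  move=> /bnd/andP[h0 h1]; rewrite ffunE inordK// ltnS.
  by rewrite -(ler_nat R) (le_trans _ h1)// truncn_le.
have := truncE _ hZ; have := truncE _ hZ'; rewrite ZZ' => -> e1.
have /andP[/truncn_itv/andP[a1 a2] _] := bnd _ hZ.
have /andP[/truncn_itv/andP[b1 b2] _] := bnd _ hZ'.
rewrite -e1 in a1 a2.
rewrite -div1r ler_pdivlMr ?exprn_gt0// -exprMn.
have -> : (Z i k l - Z' i k l) * M%:R =
  (Z i k l + 1) * M%:R - (Z' i k l + 1) * M%:R by ring.
set t := Num.truncn _ in a1 a2 b1 b2.
have tS : t.+1%:R = t%:R + 1 :> R by rewrite natr1.
move: a1 a2 b1 b2; rewrite tS; move: (t%:R : R) ((Z i k l + 1) * M%:R) ((Z' i k l + 1) * M%:R) => w u v a1 a2 b1 b2.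
have h1 : u - v <= 1 by lra.
have h2 : -1 <= u - v by lra.
by nra.
Qed.

(* By minimality of the net and Hall's theorem, the net and its translate can
   be matched at small distance; the uniform measure on the net is thus an
   approximate Haar measure. *)
Lemma almost_invariant_net (e : R) : 0 < e ->
  exists (I : finType) (N : I -> params),
    [/\ (0 < #|I|)%N, forall x, parameter_space (N x) &
    forall g, parameter_space g -> exists f : I -> I, injective f /\
      forall x, sqdist (translate (N x) g) (N (f x)) <= 4 * e].
Proof.
move=> e0.
pose has_net m := `[< exists (I : finType) (N : I -> params), is_net e N /\ #|I| = m >].
have ex : exists m, has_net m.
  by have [I [N hN]] := finite_net e0; exists #|I|; apply/asboolP; exists I, N.
have [m /asboolP[I [N [[NP Ne] Im]]] mmin] := ex_minnP ex.
have [x0 _] : exists x0 : I, sqdist (fun=> 1%:M) (N x0) <= e.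
  by apply: Ne => i; exact: orthogonal1.
exists I, N; split => //; first by apply/card_gt0P; exists x0.
move=> g hg.
(* [4 * e] is what [sqdist_trans] gives for two points within [e] of a third. *)
pose r x y := sqdist (translate (N x) g) (N y) <= 4 * e.
suff [f [injf fP]] : exists f : I -> I, injective f /\ forall x, r x (f x).
  by exists f.
apply: hall_marriage => // S.
set G := [set y | [exists x in S, r x y]]%SET.
rewrite leqNgt; apply/negP => ltGS.
(* If [S] had too few neighbours, these together with the translates of the points outside [S] would
   be a net smaller than the minimal one. *)
pose J : finType := ({y : I | y \in G} + {x : I | x \in ~: S}%SET)%type.
pose NJ (z : J) := match z with
  | inl y => N (val y) | inr x => translate (N (val x)) g end.
have cardJ : #|J| = (#|G| + #|~: S|%SET)%N by rewrite card_sum !card_sig.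
suff netJ : is_net e NJ.
  have := mmin _ (introT (asboolP _) (ex_intro _ J (ex_intro _ NJ (conj netJ erefl)))).
  by rewrite -Im cardJ -(cardsC S) leq_add2r leqNgt ltGS.
split; first by move=> [[y yG]|[x xS]] /=; [exact: NP|exact: translate_in].
move=> Z hZ.
(* [Z] moved back by [g] is close to some [N x], hence [Z] is close to the translate of [N x]. When
   [x] lies in [S], any point of the net close to [Z] is a neighbour of [x]. *)
pose Zg := translate Z (fun i => (g i)^T).
have ZgK : translate Zg g = Z.
  apply/funext => i; rewrite /Zg /translate -mulmxA.
  by have [_ ->] := hg i; rewrite mulmx1.
have hZg : parameter_space Zg.
  by apply: translate_in => // i; exact: orthogonal_trmx.
have [x hx] := Ne _ hZg.
rewrite -(sqdist_translate _ _ hg) ZgK in hx.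
have [xS|xS] := boolP (x \in S); last first.
  have xCS : x \in (~: S)%SET by rewrite inE.
  by exists (inr (exist _ x xCS)).
have [y hy] := Ne _ hZ.
have yG : y \in G.
  rewrite inE; apply/existsP; exists x; rewrite xS/=.
  rewrite /r (le_trans (sqdist_trans _ Z _))// sqdistC.
  by move: hx hy; rewrite /=; lra.
by exists (inl (exist _ y yG)).
Qed.

End nets.

(** * Rotating a pair *)

Section givens.
Context (R : realType) (d : nat).
Variables (k l : 'I_d) (c s : R).
Hypotheses (kl : k != l) (cs1 : c ^+ 2 + s ^+ 2 = 1).

Let E : 'M[R]_d := delta_mx k l - delta_mx l k.
Let D : 'M[R]_d := delta_mx k k + delta_mx l l.

(** The rotation with cosine [c] and sine [s] in the plane [(k, l)], written in the span of [1],
    [E], [D]. Since [E * E = - D], [E * D = D * E = E] and [D * D = D], products reduce to scalar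
    identities. *)
Definition givens : 'M[R]_d :=
  1%:M + s *: (delta_mx k l - delta_mx l k) - (1 - c) *: (delta_mx k k + delta_mx l l).

Let lk : (l == k) = false. Proof. by rewrite eq_sym (negbTE kl). Qed.

Let EE : E *m E = - D.
Proof.
rewrite /E /D mulmxBl !mulmxBr !mul_delta_mx_cond !eqxx (negbTE kl) lk.
by rewrite !mulr1n !mulr0n sub0r subr0 opprD.
Qed.

Let ED : E *m D = E.
Proof.
rewrite /E /D mulmxBl !mulmxDr !mul_delta_mx_cond !eqxx (negbTE kl) lk.
by rewrite !mulr1n !mulr0n add0r addr0.
Qed.

Let DE : D *m E = E.
Proof.
rewrite /E /D mulmxDl !mulmxBr !mul_delta_mx_cond !eqxx (negbTE kl) lk.
by rewrite !mulr1n !mulr0n sub0r subr0.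
Qed.

Let DD : D *m D = D.
Proof.
rewrite /D mulmxDl !mulmxDr !mul_delta_mx_cond !eqxx (negbTE kl) lk.
by rewrite !mulr1n !mulr0n add0r addr0.
Qed.

Let trE : E^T = - E. Proof. by rewrite /E linearB/= !trmx_delta opprB. Qed.
Let trD : D^T = D. Proof. by rewrite /D linearD/= !trmx_delta. Qed.

Lemma givens_tr :
  givens^T = 1%:M - s *: (delta_mx k l - delta_mx l k) - (1 - c) *: (delta_mx k k + delta_mx l l).
Proof.
by rewrite /givens -/E -/D linearB linearD/= !linearZ/= trmx1 trE trD scalerN.
Qed.

Let mul_span (x y z w : R) :
  (1%:M + x *: E + y *: D) *m (1%:M + z *: E + w *: D) =
  1%:M + (x + z + x * w + y * z) *: E + (y + w + y * w - x * z) *: D.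
Proof.
rewrite !mulmxDl !mulmxDr !mul1mx !mulmx1 -!scalemxAl -!scalemxAr EE ED DE DD.
by clear; move: E D => X Y; apply/matrixP => i j; rewrite !mxE; ring.
Qed.

Lemma givens_orthogonal : orthogonal_group givens.
Proof.
have scal : (1 - c) ^+ 2 + s ^+ 2 = 2 * (1 - c).
  transitivity (1 - 2 * c + (c ^+ 2 + s ^+ 2)); first by ring.
  by rewrite cs1; ring.
rewrite /orthogonal_group /= givens_tr /givens -/E -/D -!scaleNr !mul_span.
split.
  rewrite (_ : s - s + _ + _ = 0) ?scale0r ?addr0; last by ring.
  rewrite (_ : _ - _ = (1 - c) ^+ 2 + s ^+ 2 - 2 * (1 - c)); last by ring.
  by rewrite scal subrr scale0r addr0.
rewrite (_ : - s + s + _ + _ = 0) ?scale0r ?addr0; last by ring.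
rewrite (_ : _ - _ = (1 - c) ^+ 2 + s ^+ 2 - 2 * (1 - c)); last by ring.
by rewrite scal subrr scale0r addr0.
Qed.

Let trace_delta (i j : 'I_d) : \tr (delta_mx i j : 'M[R]_d) = (i == j)%:R.
Proof.
rewrite /mxtrace (bigD1 i)//= big1 ?addr0; first by rewrite mxE eqxx.
by move=> a /negbTE ai; rewrite mxE ai.
Qed.

Lemma sqnorm_givens_sub1 : sqnorm (givens - 1%:M) = 2 * (s ^+ 2 + (1 - c) ^+ 2).
Proof.
have -> : givens - 1%:M = s *: E - (1 - c) *: D.
  by rewrite /givens -/E -/D; move: E D => X Y; apply/matrixP => i j; rewrite !mxE; ring.
have trM : (s *: E - (1 - c) *: D)^T = - (s *: E) - (1 - c) *: D.
  by rewrite linearB/= !linearZ/= trE trD scalerN.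
have trD2 : \tr D = 2.
  by rewrite /D mxtraceD !trace_delta !eqxx.
rewrite sqnormE trM mulmxBl !mulmxBr !mulmxN -!scalemxAl -!scalemxAr EE ED DE DD.
rewrite (_ : _ - _ = (s ^+ 2 + (1 - c) ^+ 2) *: D).
  by rewrite mxtraceZ trD2 mulrC.
by clear trM trD2; move: E D => X Y; apply/matrixP => i j; rewrite !mxE; ring.
Qed.

(** The pair formed by [Q k k + Q l l] and [Q k l - Q l k] behaves as a complex number under plane
    rotations. The same rotation on both sides multiplies it twice, so the cosine and sine of the
    double angle appear. *)
Lemma conj_givens_entry (Q : 'M[R]_d) :
  let Q' := givens^T *m Q *m givens^T in
  Q' k l - Q' l k =
    (c ^+ 2 - s ^+ 2) * (Q k l - Q l k) - 2 * s * c * (Q k k + Q l l).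
Proof.
have sum2 (x y : R) (F : 'I_d -> R) :
    \sum_a (x * (a == k)%:R + y * (a == l)%:R) * F a = x * F k + y * F l.
  rewrite (bigD1 k)//= (bigD1 l)//= ?lk// big1 ?addr0.
    by rewrite !eqxx (negbTE kl) ?lk !mulr1 !mulr0 addr0 add0r.
  by move=> a /andP[/negbTE -> /negbTE ->]; rewrite !mulr0 addr0 mul0r.
move=> Q'.
have Q'E i j x y z w :
    (forall a, givens^T i a = x * (a == k)%:R + y * (a == l)%:R) ->
    (forall a, givens^T a j = z * (a == k)%:R + w * (a == l)%:R) ->
    Q' i j = z * (x * Q k k + y * Q l k) + w * (x * Q k l + y * Q l l).
  move=> hi hj; rewrite /Q' mxE.
  transitivity (\sum_a (z * (a == k)%:R + w * (a == l)%:R) * (x * Q k a + y * Q l a)).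
    apply: eq_bigr => a _; rewrite hj mulrC; congr (_ * _).
    by rewrite mxE -(sum2 x y (fun b => Q b a)); apply: eq_bigr => b _; rewrite hi.
  by rewrite (sum2 z w (fun a => x * Q k a + y * Q l a)).
have kl' : (k == l) = false by exact: negbTE.
have entries a : [/\ givens^T k a = c * (a == k)%:R + (- s) * (a == l)%:R,
    givens^T a l = (- s) * (a == k)%:R + c * (a == l)%:R,
    givens^T l a = s * (a == k)%:R + c * (a == l)%:R &
    givens^T a k = c * (a == k)%:R + s * (a == l)%:R].
  rewrite givens_tr !mxE !eqxx !kl' !lk (eq_sym k a) (eq_sym l a).
  case: (a =P k) => [->|_].
    by rewrite kl' /=; split; ring.
  by case: (a == l); split => /=; ring.
rewrite (Q'E k l c (- s) (- s) c); [|by move=> a; case: (entries a)..].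
rewrite (Q'E l k s c c s); [|by move=> a; case: (entries a)..].
ring.
Qed.

End givens.

(** * Sums over ordered pairs of distinct indices *)

Section off_diagonal.
Context (R : realType) (d : nat).

Lemma sum_off_diagonal (F : 'I_d -> 'I_d -> R) :
  \sum_(q : 'I_d * 'I_d | q.1 != q.2) F q.1 q.2 =
  \sum_k \sum_l F k l - \sum_k F k k.
Proof.
rewrite -(pair_big_dep xpredT (fun k l => k != l))/= -sumrB.
apply: eq_bigr => k _; rewrite [in RHS](bigD1 k)//= addrC addrK.
by apply: eq_bigl => l; rewrite eq_sym.
Qed.

Lemma sum_off_diagonal_cst (x : R) :
  \sum_(q : 'I_d * 'I_d | q.1 != q.2) x = d%:R * (d%:R - 1) * x.
Proof.
by rewrite (sum_off_diagonal (fun _ _ => x)) !sumr_const !card_ord; ring.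
Qed.

Lemma sum_off_diagonal_trace (Q : 'M[R]_d) :
  \sum_(q : 'I_d * 'I_d | q.1 != q.2) (Q q.1 q.1 + Q q.2 q.2) =
  2 * (d%:R - 1) * \tr Q.
Proof.
rewrite (sum_off_diagonal (fun k l => Q k k + Q l l)).
under eq_bigr do rewrite big_split/= sumr_const card_ord.
rewrite !big_split/= sumr_const card_ord sumrMnl -/(mxtrace Q).
by move: (\tr Q) => t; ring.
Qed.

(** The identity is symmetric, so [Q] and [Q - 1%:M] have the same skew entries, and a squared
    difference is at most twice the sum of squares. *)
Lemma sum_off_diagonal_skew (Q : 'M[R]_d) :
  \sum_(q : 'I_d * 'I_d | q.1 != q.2) (Q q.1 q.2 - Q q.2 q.1) ^+ 2 <=
  4 * sqnorm (Q - 1%:M).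
Proof.
rewrite (sum_off_diagonal (fun k l => (Q k l - Q l k) ^+ 2)).
rewrite [X in _ - X]big1 ?subr0; last by move=> k _; rewrite subrr expr0n.
pose M := Q - 1%:M.
apply: (@le_trans _ _ (\sum_k \sum_l (2 * M k l ^+ 2 + 2 * M l k ^+ 2))).
  apply: ler_sum => k _; apply: ler_sum => l _.
  have -> : Q k l - Q l k = M k l - M l k.
    by rewrite !mxE (eq_sym l k); ring.
  by have := sqr_ge0 (M k l + M l k); nra.
under eq_bigr do rewrite big_split/=.
rewrite big_split/= [X in _ + X]exchange_big/=.
have -> : \sum_k \sum_l 2 * M k l ^+ 2 = 2 * sqnorm M.
  by rewrite /sqnorm mulr_sumr; apply: eq_bigr => k _; rewrite mulr_sumr.
lra.
Qed.

End off_diagonal.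

(** * Linearization of the chi-square divergence *)

Section exponential_bounds.
Context (R : realType).

(** It follows from [expR x <= 1 / (1 - x)], which is the tangent bound at [- x]. *)
Lemma expR_le_quadratic (x : R) : 0 <= x -> x <= 1 / 2 -> expR x <= 1 + x * (1 + 2 * x).
Proof.
move=> x0 x1; have h : 1 - x <= expR (- x) by exact: expR_ge1Dx.
have h1 : expR x * expR (- x) = 1 by rewrite -expRD subrr expR0.
have h2 : expR x * (1 - x) <= 1 by rewrite -[leRHS]h1 ler_pM2l ?expR_gt0.
rewrite -(@ler_pM2r _ (1 - x)); last by lra.
apply: (le_trans h2); nra.
Qed.

(** With [S] the sum, each factor is at most [expR (p * x i * (1 + 2 * S))]; the product is one
    exponential, expanded again. The leading term [p * S] stays exact; the 8 comes from
    [(1 + 2 * S) * (1 + 4 * S)] with [S <= 1 / 4]. *)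
Lemma prod_expR_le (I : finType) (p : R) (x : I -> R) :
  0 <= p -> p <= 1 -> (forall i, 0 <= x i) -> \sum_i x i <= 1 / 4 ->
  \prod_i (1 - p + p * expR (x i)) - 1 <=
  p * (\sum_i x i) * (1 + 8 * \sum_i x i).
Proof.
move=> p0 p1 x0; set S := \sum_i x i => S1.
have S0 : 0 <= S by exact: sumr_ge0.
have xS i : x i <= S by rewrite /S (bigD1 i)//= lerDl sumr_ge0.
have hy : \prod_i (1 - p + p * expR (x i)) <= expR (p * S * (1 + 2 * S)).
  rewrite mulrAC mulr_sumr expR_sum; apply: ler_prod => i _.
  have e1 : 1 <= expR (x i) by rewrite -expR0 ler_expR.
  apply/andP; split; first by nra.
  have e2 := @expR_le_quadratic (x i) (x0 i) _.
  apply: le_trans (expR_ge1Dx _).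
  have {}e2 : expR (x i) <= 1 + x i * (1 + 2 * S).
    apply: le_trans (e2 _) _; first by have := xS i; lra.
    by have := xS i; have := x0 i; nra.
  by rewrite -[leLHS]addrA lerD2l; nra.
have y0 : 0 <= p * S * (1 + 2 * S) by rewrite !mulr_ge0//; lra.
have yS : p * S * (1 + 2 * S) <= 2 * S by nra.
have y1 : p * S * (1 + 2 * S) <= 1 / 2 by lra.
have := expR_le_quadratic y0 y1.
set y := p * S * (1 + 2 * S) in hy y0 yS y1 *.
move=> h; have : \prod_i (1 - p + p * expR (x i)) - 1 <= y * (1 + 2 * y) by lra.
move=> /le_trans; apply.
have h1 : y * (1 + 2 * y) <= y * (1 + 4 * S) by apply: ler_wpM2l => //; lra.
apply: (le_trans h1).
rewrite /y -!mulrA ler_wpM2l// ler_wpM2l//; nra.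
Qed.

End exponential_bounds.

(** * Displacement of the signals *)

Section signal_distance.
Context (R : realType) (n d : nat).

Lemma sum_edges_le (F : 'I_n -> 'I_n -> R) :
  (forall u v, 0 <= F u v) -> (forall u v, F u v = F v u) ->
  2 * \sum_(e : edge n) F (edge_fst e) (edge_snd e) <= \sum_u \sum_v F u v.
Proof.
move=> F0 Fsym.
have [le1 le2] : \sum_(e : edge n) F (edge_fst e) (edge_snd e) =
    \sum_(q : 'I_n * 'I_n | (q.1 < q.2)%N) F q.1 q.2 /\
    \sum_(e : edge n) F (edge_fst e) (edge_snd e) =
    \sum_(q : 'I_n * 'I_n | (q.2 < q.1)%N) F q.1 q.2.
  have e1 : \sum_(e : edge n) F (edge_fst e) (edge_snd e) =
      \sum_(q : 'I_n * 'I_n | (q.1 < q.2)%N) F q.1 q.2.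
    by rewrite -(big_sub _ (fun q : 'I_n * 'I_n => F q.1 q.2)).
  split => //; rewrite e1 (reindex_inj (h := fun q => (q.2, q.1)))/=.
    by apply: eq_bigr => q _; rewrite Fsym.
  by move=> [a b] [a' b'] /= [-> ->].
rewrite mulrDl mul1r {1}le1 le2 pair_big/=.
rewrite [leRHS](bigID (fun q : 'I_n * 'I_n => (q.1 < q.2)%N))/= lerD2l.
rewrite [leRHS](bigID (fun q : 'I_n * 'I_n => (q.2 < q.1)%N))/=.
rewrite (eq_bigl (fun q : 'I_n * 'I_n => ~~ (q.1 < q.2)%N && (q.2 < q.1)%N)).
  by rewrite lerDl sumr_ge0.
by move=> q /=; rewrite -leqNgt andb_idl// => /ltnW.
Qed.

Lemma signal_translate (Z g : 'I_n -> 'M[R]_d) (e : edge n) :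
  parameter_space Z -> parameter_space g ->
  sqnorm (signal (translate Z g) e - signal Z e) =
  sqnorm (g (edge_fst e) - g (edge_snd e)).
Proof.
move=> hZ hg; rewrite /signal /translate.
set u := edge_fst e; set v := edge_snd e.
rewrite -[RHS](sqnorm_mulmx_orthogonal _ (orthogonal_trmx (hg v))).
rewrite -[RHS](sqnorm_orthogonal_mulmx _ (hZ u)).
rewrite -[RHS](sqnorm_mulmx_orthogonal _ (orthogonal_trmx (hZ v))).
congr sqnorm; rewrite trmx_mul mulmxBl mulmxBr mulmxBl (hg v).1 mulmx1.
by rewrite !mulmxA.
Qed.

(** Up to orthogonal factors, the signal of an edge moves by [g u - g v]. Centring at the identity
    brings in [pairwise_sqnorm_le], whose factor 2 disappears because edges are unordered pairs. *)
Lemma sum_signal_translate (Z g : 'I_n -> 'M[R]_d) :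
  parameter_space Z -> parameter_space g ->
  \sum_(e : edge n) sqnorm (signal (translate Z g) e - signal Z e) <=
  n%:R * \sum_u sqnorm (g u - 1%:M).
Proof.
move=> hZ hg; under eq_bigr do rewrite signal_translate//.
have h : 2 * \sum_(e : edge n) sqnorm (g (edge_fst e) - g (edge_snd e)) <=
    \sum_u \sum_v sqnorm (g u - g v).
  apply: (@sum_edges_le (fun u v => sqnorm (g u - g v))) => u v.
    exact: sqnorm_ge0.
  by rewrite -sqnormN opprB.
have e : \sum_u \sum_v sqnorm (g u - g v) =
    \sum_u \sum_v sqnorm ((g u - 1%:M) - (g v - 1%:M)).
  by apply: eq_bigr => u _; apply: eq_bigr => v _; rewrite opprB addrA subrK.
rewrite e in h; have := le_trans h (pairwise_sqnorm_le (fun u => g u - 1%:M)).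
by rewrite -mulrA ler_pM2l.
Qed.

Lemma sum_signal_sqdist (Z Z' : 'I_n -> 'M[R]_d) :
  parameter_space Z -> parameter_space Z' ->
  \sum_(e : edge n) sqnorm (signal Z' e - signal Z e) <=
  #|edge n|%:R * (4 * sqdist Z Z').
Proof.
move=> hZ hZ'.
rewrite mulr_natl -sumr_const; apply: ler_sum => e _.
have le1 := sqnorm_le_sqdist Z Z'.
rewrite /signal; set u := edge_fst e; set v := edge_snd e.
have -> : Z' u *m (Z' v)^T - Z u *m (Z v)^T =
  (Z' u - Z u) *m (Z' v)^T + Z u *m (Z' v - Z v)^T.
  by rewrite mulmxBl linearB/= mulmxBr addrA subrK.
apply: (le_trans (sqnormD_le _ _)).
rewrite sqnorm_mulmx_orthogonal; last exact: orthogonal_trmx.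
rewrite sqnorm_orthogonal_mulmx// sqnorm_trmx.
by have := le1 u; have := le1 v; lra.
Qed.

End signal_distance.

(** * Rotating the two ends of a pair *)

Section relative_rotation.
Context (R : realType) (n d : nat).
Notation params := ('I_n -> 'M[R]_d).

(* [residual Zhat Z i j] is the identity exactly when [Zhat] recovers
   [Z_i Z_j^T]. *)
Definition residual (Zhat Z : params) (i j : 'I_n) : 'M[R]_d :=
  (Z i)^T *m (Zhat i *m (Zhat j)^T) *m Z j.

Definition skew_part (Zhat Z : params) (i j : 'I_n) (k l : 'I_d) : R :=
  residual Zhat Z i j k l - residual Zhat Z i j l k.

(** Opposite rotations put the same factor on both sides of the residual, so the angles add. Equal
    rotations would conjugate it and leave its skew entry [(k, l)] unchanged. *)
Definition pair_rotation (i j : 'I_n) (k l : 'I_d) (c s : R) : params :=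
  fun u => if u == i then givens k l c s else
           if u == j then (givens k l c s)^T else 1%:M.

Section fixed.
Variables (Zhat Z : params) (i j : 'I_n).
Hypotheses (hZhat : parameter_space Zhat) (hZ : parameter_space Z).

Lemma residual_orthogonal : orthogonal_group (residual Zhat Z i j).
Proof.
apply: orthogonal_mulmx; last exact: hZ.
apply: orthogonal_mulmx; first exact: orthogonal_trmx.
by apply: orthogonal_mulmx => //; exact: orthogonal_trmx.
Qed.

Lemma pair_error_residual :
  pair_error Zhat Z i j = sqnorm (residual Zhat Z i j - 1%:M).
Proof.
rewrite /pair_error -(sqnorm_orthogonal_mulmx _ (orthogonal_trmx (hZ i))).
rewrite -(sqnorm_mulmx_orthogonal _ (hZ j)) mulmxBr mulmxBl.
congr (sqnorm (_ - _)).
by rewrite mulmxA (hZ i).2 mul1mx (hZ j).2.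
Qed.

Lemma pair_error_trace :
  pair_error Zhat Z i j = 2 * (d%:R - \tr (residual Zhat Z i j)).
Proof.
rewrite pair_error_residual sqnorm_sub_orthogonal.
- by rewrite trmx1 mul1mx.
- exact: residual_orthogonal.
- exact: orthogonal1.
Qed.

Lemma residual_entry_le k l : `|residual Zhat Z i j k l| <= 1.
Proof.
have := orthogonal_entry k l residual_orthogonal.
by move=> h; rewrite ler_norml; apply/andP; split; nra.
Qed.

End fixed.

Lemma pair_rotation_in i j k l c s : k != l -> c ^+ 2 + s ^+ 2 = 1 ->
  parameter_space (pair_rotation i j k l c s).
Proof.
move=> kl cs u; rewrite /pair_rotation; case: ifP => _; first exact: givens_orthogonal.
case: ifP => _; last exact: orthogonal1.
by apply: orthogonal_trmx; exact: givens_orthogonal.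
Qed.

Lemma skew_part_rotation Zhat Z i j k l c s : i != j -> k != l ->
  let Q := residual Zhat Z i j in
  skew_part Zhat (translate Z (pair_rotation i j k l c s)) i j k l =
  (c ^+ 2 - s ^+ 2) * skew_part Zhat Z i j k l - 2 * s * c * (Q k k + Q l l).
Proof.
move=> ij kl Q; rewrite /skew_part -(conj_givens_entry c s kl).
rewrite /residual /translate /pair_rotation !eqxx (eq_sym j) (negbTE ij).
by rewrite /Q /residual !trmx_mul !mulmxA.
Qed.

Lemma sum_pair_rotation i j k l c s : k != l -> c ^+ 2 + s ^+ 2 = 1 ->
  \sum_u sqnorm (pair_rotation i j k l c s u - 1%:M) <=
  4 * (s ^+ 2 + (1 - c) ^+ 2).
Proof.
move=> kl cs.
pose a := 2 * (s ^+ 2 + (1 - c) ^+ 2).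
have a0 : 0 <= a by rewrite mulr_ge0// addr_ge0// sqr_ge0.
have h : \sum_u sqnorm (pair_rotation i j k l c s u - 1%:M) <=
    \sum_u (a * (u == i)%:R + a * (u == j)%:R).
  apply: ler_sum => u _; rewrite /pair_rotation.
  have gE : sqnorm (givens k l c s - 1%:M) = a by rewrite sqnorm_givens_sub1.
  have gtE : sqnorm ((givens k l c s)^T - 1%:M) = a.
    by rewrite -sqnorm_trmx linearB/= trmxK trmx1.
  case: (u == i); first by rewrite gE mulr1 lerDl mulr_ge0.
  case: (u == j); first by rewrite gtE mulr1 mulr0 add0r.
  rewrite subrr !mulr0 addr0 [sqnorm _]big1// => k' _.
  by rewrite big1// => l' _; rewrite mxE expr0n.
apply: (le_trans h); rewrite big_split/= -!mulr_sumr.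
have one v : \sum_u (u == v)%:R = 1 :> R.
  by rewrite (bigD1 v)//= eqxx big1 ?addr0// => u /negbTE ->.
by rewrite !one /a; lra.
Qed.

End relative_rotation.

(** In the application [a] and [b] are the cosine and sine of the double angle, [x] is the skew
    entry and [z] the diagonal sum. An error of first order in [b] is affordable: it is later
    multiplied by [lam], which is also of the order of the angle. *)
Lemma rotated_sqr_le (R : realType) (a b x z : R) :
  0 <= a -> a <= 1 -> 0 <= b -> b <= 1 -> `|x| <= 2 -> `|z| <= 2 ->
  (a * x - b * z) ^+ 2 <= x ^+ 2 + 12 * b.
Proof.
move=> a0 a1 b0 b1; rewrite !ler_norml => /andP[x1 x2] /andP[z1 z2].
have xz : - (x * z) <= 4.
  have e1 : 0 <= (2 + x) * (2 + z) by apply: mulr_ge0; lra.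
  have e2 : 0 <= (2 - x) * (2 - z) by apply: mulr_ge0; lra.
  lra.
have e1 : a ^+ 2 * x ^+ 2 <= x ^+ 2 by rewrite ler_piMl ?sqr_ge0// expr_le1.
have e2 : a * b * - (x * z) <= 4 * b.
  have ab : a * b <= b by rewrite ler_piMl.
  have ab0 : 0 <= a * b by rewrite mulr_ge0.
  by have := ler_wpM2l ab0 xz; lra.
have e3 : b ^+ 2 * z ^+ 2 <= 4 * b.
  have bb : b ^+ 2 <= b by rewrite expr2 ler_piMl.
  have zz : z ^+ 2 <= 4.
    have : 0 <= (2 + z) * (2 - z) by apply: mulr_ge0; lra.
    by rewrite expr2; lra.
  by have := ler_pM (sqr_ge0 b) (sqr_ge0 z) bb zz; lra.
rewrite (_ : _ ^+ 2 = a ^+ 2 * x ^+ 2 + 2 * (a * b * - (x * z)) + b ^+ 2 * z ^+ 2).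
  lra.
by ring.
Qed.

Lemma rotated_gain_le (R : realType) (lam a b x z : R) :
  0 < lam -> 0 <= a -> a <= 1 -> 0 <= b -> b <= 1 -> `|x| <= 2 -> `|z| <= 2 ->
  lam / 2 * (a * x - b * z) ^+ 2 + (a * x - b * z - x) <=
  lam / 2 * (x ^+ 2 + 12 * b) + 2 * (1 - a) - b * z.
Proof.
move=> lam0 a0 a1 b0 b1 x2 z2.
have h1 := rotated_sqr_le a0 a1 b0 b1 x2 z2.
have h2 : (a - 1) * x <= 2 * (1 - a).
  move: x2; rewrite ler_norml => /andP[x1 x2].
  have : 0 <= (1 - a) * (2 + x) by apply: mulr_ge0; lra.
  lra.
have h3 : lam / 2 * (a * x - b * z) ^+ 2 <= lam / 2 * (x ^+ 2 + 12 * b).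
  by rewrite ler_wpM2l// divr_ge0// ltW.
rewrite (_ : a * x - b * z - x = (a - 1) * x - b * z); last by ring.
lra.
Qed.

Lemma increment_combine (R : realType) (lam a b e m2 mb x X : R) :
  0 < lam -> a - b <= (lam * m2 + x / lam) / 2 -> lam / 2 * m2 + (b - e) <= mb ->
  x <= X -> a - e <= mb + X / (2 * lam).
Proof.
move=> lam0 h1 h2 xX.
have h3 : x / lam / 2 <= X / (2 * lam).
  rewrite (_ : X / (2 * lam) = X / lam / 2); last by field; rewrite gt_eqF.
  by rewrite !ler_pM2r// invr_gt0.
lra.
Qed.

Lemma increment_sum_le (R : realType) (lam S e b a D t x : R) :
  0 < lam -> S <= 4 * e ->
  lam / 2 * (S + D * (12 * b)) + D * (2 * (1 - a)) - b * t * (x - e) <=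
  2 * lam * e + 6 * lam * b * D + 2 * (1 - a) * D - b * t * x + b * t * e.
Proof.
move=> lam0 h; have h' : lam / 2 * S <= lam / 2 * (4 * e).
  by rewrite ler_wpM2l// divr_ge0// ltW.
lra.
Qed.

(** * The increment inequality for one pair *)

Section pair_risk.
Context disp (T : measurableType disp) (R : realType) (P : probability T R).
Variables (n d : nat) (p sigma : R) (A : edge n -> {RV P >-> bool})
  (W : edge n -> 'I_d -> 'I_d -> {RV P >-> R}).
Hypotheses (p_gt0 : 0 < p) (p_le1 : p <= 1) (sigma_gt0 : 0 < sigma).
Hypothesis AW : sync_model p A W.
Variable Zhat : data R n d -> 'I_n -> 'M[R]_d.
Hypothesis hZhat : estimator Zhat.

Notation params := ('I_n -> 'M[R]_d).
Notation mean := (mean sigma A W).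

Let Zhat_in y : parameter_space (Zhat y). Proof. exact: hZhat.1. Qed.

Definition mx_admissible a b (F : data R n d -> 'M[R]_(a, b)) : Prop :=
  forall k l, admissible (fun y => F y k l).

Lemma mx_admissible_cst a b (M : 'M[R]_(a, b)) : mx_admissible (fun=> M).
Proof. by move=> k l; exact: admissible_cst. Qed.

Lemma mx_admissible_mulmx a b e (F : data R n d -> 'M[R]_(a, b))
    (G : data R n d -> 'M[R]_(b, e)) :
  mx_admissible F -> mx_admissible G -> mx_admissible (fun y => F y *m G y).
Proof.
move=> hF hG k l; under eq_fun do rewrite mxE.
by apply: admissible_sum => i _; exact: admissibleM.
Qed.

Lemma mx_admissible_trmx a b (F : data R n d -> 'M[R]_(a, b)) :
  mx_admissible F -> mx_admissible (fun y => (F y)^T).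
Proof. by move=> hF k l; under eq_fun do rewrite mxE; exact: hF. Qed.

Lemma mx_admissible_estimator i : mx_admissible (fun y => Zhat y i).
Proof.
move=> k l; split; first exact: hZhat.2.
exists 1 => y; have := orthogonal_entry k l (Zhat_in y i).
by move=> h; rewrite ler_norml; apply/andP; split; nra.
Qed.

Lemma mx_admissible_residual Z i j : mx_admissible (fun y => residual (Zhat y) Z i j).
Proof.
apply: mx_admissible_mulmx; last exact: mx_admissible_cst.
apply: mx_admissible_mulmx; first exact: mx_admissible_cst.
apply: mx_admissible_mulmx; first exact: mx_admissible_estimator.
by apply: mx_admissible_trmx; exact: mx_admissible_estimator.
Qed.

Lemma admissible_skew_part Z i j k l : admissible (fun y => skew_part (Zhat y) Z i j k l).
Proof.
by apply: admissibleD; [|apply: admissibleN]; exact: mx_admissible_residual.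
Qed.

Lemma admissible_pair_error Z i j : admissible (fun y => pair_error (Zhat y) Z i j).
Proof.
rewrite /pair_error /sqnorm; apply: admissible_sum => k _; apply: admissible_sum => l _.
under eq_fun do rewrite !mxE expr2.
suff h : admissible (fun y => \sum_(j0 < d) Zhat y i k j0 * (Zhat y j)^T j0 l +
    - (\sum_(j0 < d) Z i k j0 * (Z j)^T j0 l)) by exact: admissibleM.
apply: admissibleD; last exact: admissible_cst.
apply: admissible_sum => q _; apply: admissibleM; first exact: mx_admissible_estimator.
by apply: (mx_admissible_trmx (F := fun y => Zhat y j)); exact: mx_admissible_estimator.
Qed.

Definition skew_mean (Z : params) i j k l : R :=
  mean Z (fun y => skew_part (Zhat y) Z i j k l).

Definition pair_risk (Z : params) i j : R :=
  mean Z (fun y => pair_error (Zhat y) Z i j).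

Lemma pair_risk_ge0 Z i j : 0 <= pair_risk Z i j.
Proof.
rewrite -(@mean_cst _ T R P n d sigma A W Z 0); apply: mean_le.
- exact: admissible_cst.
- exact: admissible_pair_error.
- by move=> y; exact: sqnorm_ge0.
Qed.

Lemma chi2_le (Z Z' : params) : (\sum_(e : edge n) sqnorm (signal Z' e - signal Z e)) / sigma ^+ 2 <= 1 / 4 ->
  chi2 p sigma Z Z' <=
  p * ((\sum_(e : edge n) sqnorm (signal Z' e - signal Z e)) / sigma ^+ 2) *
  (1 + 8 * ((\sum_(e : edge n) sqnorm (signal Z' e - signal Z e)) / sigma ^+ 2)).
Proof.
rewrite mulr_suml => h; apply: prod_expR_le => //; first exact: ltW.
by move=> e; rewrite divr_ge0 ?sqr_ge0//; exact: sqnorm_ge0.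
Qed.

(* The score is the likelihood increment along the rotation, and the divergence
   of [Z_i E_kl Z_j^T] produces the trace of the residual. *)
Lemma skew_mean_increment (Z : params) i j (c s lam X : R) :
  parameter_space Z -> i != j -> c ^+ 2 + s ^+ 2 = 1 -> 0 <= s -> 0 <= c ->
  0 <= c ^+ 2 - s ^+ 2 -> 0 < lam ->
  (forall k l, k != l -> chi2 p sigma Z (translate Z (pair_rotation i j k l c s)) <= X) ->
  \sum_(q : 'I_d * 'I_d | q.1 != q.2)
    (skew_mean (translate Z (pair_rotation i j q.1 q.2 c s)) i j q.1 q.2
     - skew_mean Z i j q.1 q.2) <=
  2 * lam * pair_risk Z i j + 6 * lam * (2 * s * c) * (d%:R * (d%:R - 1)) +
  2 * (1 - (c ^+ 2 - s ^+ 2)) * (d%:R * (d%:R - 1)) -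
  2 * s * c * (d%:R - 1) * (2 * d%:R - pair_risk Z i j) + d%:R * (d%:R - 1) * (X / (2 * lam)).
Proof.
move=> hZ ij cs s0 c0 c20 lam0 hX; set D := d%:R * (d%:R - 1).
set c2 := c ^+ 2 - s ^+ 2 in c20 *; set s2 := 2 * s * c.
have s20 : 0 <= s2 by rewrite !mulr_ge0.
have s21 : s2 <= 1 by rewrite /s2 -[leRHS]cs; have := sqr_ge0 (c - s); rewrite sqrrB; lra.
have c21 : c2 <= 1 by rewrite /c2 -[leRHS]cs; have := sqr_ge0 s; lra.
pose Q y := residual (Zhat y) Z i j.
pose u y q := skew_part (Zhat y) Z i j q.1 q.2.
pose v y q := Q y q.1 q.1 + Q y q.2 q.2.
pose b y (q : 'I_d * 'I_d) : R := lam / 2 * (u y q ^+ 2 + 12 * s2) + 2 * (1 - c2) - s2 * v y q.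
have adm_u q : admissible (fun y => u y q) by exact: admissible_skew_part.
have adm_v q : admissible (fun y => v y q).
  by apply: admissibleD; exact: mx_admissible_residual.
have adm_b q : admissible (fun y => b y q).
  apply: admissibleD; last by apply: admissibleN; exact: admissibleZ.
  apply: admissibleD; last exact: admissible_cst.
  apply: admissibleZ; apply: admissibleD; last exact: admissible_cst.
  by under eq_fun do rewrite expr2; exact: admissibleM.
have step q : q.1 != q.2 ->
    skew_mean (translate Z (pair_rotation i j q.1 q.2 c s)) i j q.1 q.2
     - skew_mean Z i j q.1 q.2 <= mean Z (fun y => b y q) + X / (2 * lam).
  move=> q12; set Z' := translate _ _.
  pose u' y := skew_part (Zhat y) Z' i j q.1 q.2.
  have adm_u' : admissible u' by exact: admissible_skew_part.
  have adm_u'2 : admissible (fun y => u' y ^+ 2).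
    by under eq_fun do rewrite expr2; exact: admissibleM.
  have := @mean_change _ T R P n d p sigma A W (ltW p_gt0) p_le1 sigma_gt0 AW Z Z' u' lam adm_u' lam0.
  rewrite /skew_mean -/u' => h.
  (* The statistic depends on the parameter too: [mean_change] treats [u'] under the two laws, and
     the pointwise change [u' - u] supplies the drift. *)
  have hb : mean Z (fun y => lam / 2 * u' y ^+ 2 + (u' y - u y q)) <= mean Z (fun y => b y q).
    apply: mean_le => //.
      apply: admissibleD; first exact: admissibleZ.
      by apply: admissibleD => //; exact: admissibleN.
    move=> y; rewrite /u' skew_part_rotation// -/c2 -/s2 -/(Q y) -/(u y q) -/(v y q) /b.
    have Q1 k l : `|Q y k l| <= 1 by exact: residual_entry_le.
    have u2 : `|u y q| <= 2.
      by rewrite (le_trans (ler_normB _ _))// -[2]/(1 + 1) lerD.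
    have v2 : `|v y q| <= 2.
      by rewrite (le_trans (ler_normD _ _))// -[2]/(1 + 1) lerD.
    exact: rotated_gain_le.
  rewrite meanD in hb; [|exact: admissibleZ|by apply: admissibleD => //; exact: admissibleN].
  rewrite meanZ// meanB// in hb.
  exact: increment_combine h hb (hX _ _ q12).
apply: (le_trans (ler_sum _ step)).
rewrite big_split/= sum_off_diagonal_cst -/D lerD2r.
have -> : \sum_(q : 'I_d * 'I_d | q.1 != q.2) mean Z (fun y => b y q) =
    mean Z (fun y => \sum_(q : 'I_d * 'I_d | q.1 != q.2) b y q).
  by rewrite mean_sum.
set r := pair_risk Z i j.
pose B y := 2 * lam * pair_error (Zhat y) Z i j + 6 * lam * s2 * D + 2 * (1 - c2) * D
  - s2 * (d%:R - 1) * (2 * d%:R) + s2 * (d%:R - 1) * pair_error (Zhat y) Z i j.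
have adm_e := admissible_pair_error Z i j.
have -> : 2 * lam * r + 6 * lam * s2 * D + 2 * (1 - c2) * D -
    s2 * (d%:R - 1) * (2 * d%:R - r) = mean Z B.
  rewrite /B meanD; [|do 3 (apply: admissibleD; last exact: admissible_cst); exact: admissibleZ|exact: admissibleZ].
  rewrite meanD; [|do 2 (apply: admissibleD; last exact: admissible_cst); exact: admissibleZ|exact: admissible_cst].
  rewrite meanD; [|do 1 (apply: admissibleD; last exact: admissible_cst); exact: admissibleZ|exact: admissible_cst].
  rewrite meanD; [|exact: admissibleZ|exact: admissible_cst].
  have mean_fun x : mean Z (fun=> x) = x by exact: mean_cst.
  by rewrite !mean_fun !meanZ// -/(pair_risk Z i j) -/r; ring.
apply: mean_le.
- by apply: admissible_sum => q _; exact: adm_b.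
- apply: admissibleD; last exact: admissibleZ.
  do 3 (apply: admissibleD; last exact: admissible_cst).
  exact: admissibleZ.
move=> y; rewrite /b /B sumrB -mulr_sumr sum_off_diagonal_trace -/(Q y).
(* The drift sums to a multiple of the trace of the residual, which is affine in the pair error; the
   squared skew entries sum to at most four pair errors. The bound thus closes in terms of the
   risk. *)
have tr_e := pair_error_trace i j (Zhat_in y) hZ.
have sk := sum_off_diagonal_skew (Q y).
rewrite -(pair_error_residual (Zhat y) i j hZ) in sk.
rewrite big_split/= -mulr_sumr big_split/= !sum_off_diagonal_cst -/D.
rewrite -/(Q y) in tr_e.
have -> : s2 * (2 * (d%:R - 1) * \tr (Q y)) =
  s2 * (d%:R - 1) * (2 * d%:R - pair_error (Zhat y) Z i j) by rewrite tr_e; ring.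
exact: increment_sum_le.
Qed.

End pair_risk.

(** * Uniform continuity of the mean of the statistic *)

Lemma norm_le_of_sqr (R : realType) (x t : R) : 0 <= t -> x ^+ 2 <= t ^+ 2 -> `|x| <= t.
Proof.
move=> t0 xt; rewrite -[t](ger0_norm t0) -(@ler_pXn2r _ 2) ?nnegrE//.
by rewrite !real_normK ?num_real.
Qed.

Lemma sqr_le4 (R : realType) (x : R) : `|x| <= 2 -> x ^+ 2 <= 4.
Proof.
rewrite ler_norml => /andP[x1 x2].
have : 0 <= (2 + x) * (2 - x) by apply: mulr_ge0; lra.
by rewrite expr2; lra.
Qed.

Lemma chi2_bound_le (R : realType) (p x : R) : 0 <= p -> p <= 1 -> 0 <= x ->
  x <= 1 / 4 -> p * x * (1 + 8 * x) <= 3 * x.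
Proof.
move=> p0 p1 x0 x1; rewrite (mulrC 3); apply: ler_pM; [|lra| |lra].
  by rewrite mulr_ge0.
by rewrite ler_piMl.
Qed.

Lemma skew_combine (R : realType) (a b a' b' eta : R) :
  `|a' - a| <= eta / 16 -> `|b' - b| <= eta / 16 -> a' - b' <= a - b + eta / 8.
Proof. by rewrite !ler_norml => /andP[x1 x2] /andP[x3 x4]; lra. Qed.

Lemma continuity_combine (R : realType) (eta chi S a b c m2 : R) :
  0 < eta -> chi <= 3 * S -> S <= eta ^+ 2 / 24 ->
  a - b <= (eta / 4 * m2 + chi / (eta / 4)) / 2 -> m2 <= 4 -> b <= c + eta / 8 ->
  a <= c + eta.
Proof.
move=> eta0 hchi hS h1 h2 h3.
have h4 : chi / (eta / 4) <= eta / 2.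
  by rewrite ler_pdivrMr ?divr_gt0//; move: hS; rewrite expr2; lra.
have h5 : eta / 4 * m2 <= eta / 4 * 4 by apply: ler_wpM2l => //; lra.
lra.
Qed.

Section risk_continuity.
Context disp (T : measurableType disp) (R : realType) (P : probability T R).
Variables (n d : nat) (p sigma : R) (A : edge n -> {RV P >-> bool})
  (W : edge n -> 'I_d -> 'I_d -> {RV P >-> R}).
Hypotheses (p_gt0 : 0 < p) (p_le1 : p <= 1) (sigma_gt0 : 0 < sigma).
Hypothesis AW : sync_model p A W.
Variable Zhat : data R n d -> 'I_n -> 'M[R]_d.
Hypothesis hZhat : estimator Zhat.

Notation params := ('I_n -> 'M[R]_d).
Notation mean := (mean sigma A W).
Notation skew_mean := (skew_mean sigma A W Zhat).

Lemma sqnorm_residual_sub (Zh Z Z' : params) i j :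
  parameter_space Zh -> parameter_space Z -> parameter_space Z' ->
  sqnorm (residual Zh Z' i j - residual Zh Z i j) <= 4 * sqdist Z Z'.
Proof.
move=> hZh hZ hZ'.
have le1 := sqnorm_le_sqdist Z Z'.
have hT : orthogonal_group (Zh i *m (Zh j)^T).
  by apply: orthogonal_mulmx => //; exact: orthogonal_trmx.
rewrite /residual; set M := Zh i *m _ in hT *.
have -> : (Z' i)^T *m M *m Z' j - (Z i)^T *m M *m Z j =
    (Z' i - Z i)^T *m (M *m Z' j) + ((Z i)^T *m M) *m (Z' j - Z j).
  by rewrite linearB/= mulmxBl mulmxBr !mulmxA addrA subrK.
apply: (le_trans (sqnormD_le _ _)).
rewrite sqnorm_mulmx_orthogonal; last exact: orthogonal_mulmx.
rewrite sqnorm_orthogonal_mulmx; last first.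
  by apply: orthogonal_mulmx => //; exact: orthogonal_trmx.
by rewrite sqnorm_trmx; have := le1 i; have := le1 j; lra.
Qed.

(** [Zhat] is merely measurable. Continuity comes from the law of the data, which moves little in
    chi-square, and from the residual, which is Lipschitz in [Z] for fixed data. *)
Lemma skew_mean_continuous (eta : R) : 0 < eta -> exists2 e, 0 < e &
  forall Z Z', parameter_space Z -> parameter_space Z' -> sqdist Z Z' <= 4 * e ->
  forall i j k l, skew_mean Z' i j k l <= skew_mean Z i j k l + eta.
Proof.
move=> eta0.
pose m : R := #|edge n|%:R.
have m0 : 0 <= m by [].
have m1 : 0 < m + 1 by rewrite ltr_wpDl.
have s20 : 0 < sigma ^+ 2 by rewrite exprn_gt0.
have e20 : 0 < eta ^+ 2 by rewrite exprn_gt0.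
(* The 16 is the 4 of [sum_signal_sqdist] times the 4 of the hypothesis on [sqdist]; adding 1 keeps
   [K] positive without edges. Below, [a] meets the condition of [chi2_le], [b] makes the divergence
   small against [eta ^+ 2], and [c] keeps each residual entry within [eta / 16]. *)
pose K : R := 16 * (m + 1).
have K0 : 0 < K by apply: mulr_gt0.
pose a := sigma ^+ 2 / 4 / K.
pose b := eta ^+ 2 / 24 * sigma ^+ 2 / K.
pose c := (eta / 16) ^+ 2 / 16.
have a0 : 0 < a by do 2 apply: divr_gt0 => //.
have b0 : 0 < b by apply: divr_gt0 => //; apply: mulr_gt0 => //; exact: divr_gt0.
have c0 : 0 < c by apply: divr_gt0 => //; apply: exprn_gt0; exact: divr_gt0.
pose e := Num.min a (Num.min b c).
have ea : e <= a by rewrite ge_min lexx.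
have eb : e <= b by rewrite !ge_min lexx orbT.
have ec : e <= c by rewrite !ge_min lexx !orbT.
exists e; first by rewrite !lt_min a0 b0 c0.
move=> Z Z' hZ hZ' ZZ' i j k l.
set S := (\sum_(e : edge n) sqnorm (signal Z' e - signal Z e)) / sigma ^+ 2.
have S0 : 0 <= S.
  by rewrite divr_ge0 ?sqr_ge0// sumr_ge0// => q _; exact: sqnorm_ge0.
have Se : S * sigma ^+ 2 <= K * e.
  rewrite /S mulfVK ?gt_eqF//; apply: (le_trans (sum_signal_sqdist hZ hZ')).
  rewrite -/m (_ : K * e = m * (4 * (4 * e)) + 16 * e); last by rewrite /K; ring.
  have e0 : 0 <= e by rewrite ltW// !lt_min a0 b0 c0.
  rewrite -[leLHS]addr0; apply: lerD; last exact: mulr_ge0.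
  by apply: ler_wpM2l => //; apply: ler_wpM2l.
have S1 : S <= 1 / 4.
  rewrite -(ler_pM2r s20); apply: (le_trans Se).
  apply: (@le_trans _ _ (K * a)); first by rewrite ler_pM2l.
  by rewrite /a mulrCA mulfV ?gt_eqF// mulr1 mulrC mul1r.
have Seta : S <= eta ^+ 2 / 24.
  rewrite -(ler_pM2r s20); apply: (le_trans Se).
  apply: (@le_trans _ _ (K * b)); first by rewrite ler_pM2l.
  by rewrite /b mulrCA mulfV ?gt_eqF// mulr1.
have chiS : chi2 p sigma Z Z' <= 3 * S.
  apply: (le_trans (chi2_le p_gt0 p_le1 S1)); rewrite -/S.
  exact: chi2_bound_le (ltW p_gt0) p_le1 S0 S1.
pose psi y := skew_part (Zhat y) Z i j k l.
pose psi' y := skew_part (Zhat y) Z' i j k l.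
have adm : admissible psi := admissible_skew_part hZhat Z i j k l.
have adm' : admissible psi' := admissible_skew_part hZhat Z' i j k l.
have adm'2 : admissible (fun y => psi' y ^+ 2).
  by under eq_fun do rewrite expr2; exact: admissibleM.
(* With this weight the second moment, at most 4, costs [eta / 2]; the divergence costs [eta / 4]
   and the moving residual [eta / 8]. *)
have lam0 : 0 < eta / 4 by rewrite divr_gt0.
have h1 := mean_change (ltW p_gt0) p_le1 sigma_gt0 AW Z Z' adm' lam0.
have h2 : mean Z (fun y => psi' y ^+ 2) <= 4.
  rewrite -(@mean_cst _ T R P n d sigma A W Z 4); apply: mean_le => //.
    exact: admissible_cst.
  move=> y; rewrite /psi' /skew_part.
  have r1 := residual_entry_le i j (hZhat.1 y) hZ' k l.
  have r2 := residual_entry_le i j (hZhat.1 y) hZ' l k.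
  have : `|residual (Zhat y) Z' i j k l - residual (Zhat y) Z' i j l k| <= 2.
    by rewrite (le_trans (ler_normB _ _))// -[2]/(1 + 1) lerD.
  exact: sqr_le4.
have h3 : mean Z psi' <= mean Z psi + eta / 8.
  rewrite -[X in _ + X](@mean_cst _ T R P n d sigma A W Z) -meanD//; last exact: admissible_cst.
  apply: mean_le => //; first by apply: admissibleD => //; exact: admissible_cst.
  move=> y /=; rewrite /psi /psi' /skew_part.
  have hX := sqnorm_residual_sub i j (hZhat.1 y) hZ hZ'.
  have small q r : `|residual (Zhat y) Z' i j q r - residual (Zhat y) Z i j q r| <= eta / 16.
    have hqr : (residual (Zhat y) Z' i j q r - residual (Zhat y) Z i j q r) ^+ 2 <= (eta / 16) ^+ 2.
      have := sqnorm_entry (residual (Zhat y) Z' i j - residual (Zhat y) Z i j) q r.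
      rewrite !mxE => /le_trans; apply; apply: (le_trans hX).
      apply: (@le_trans _ _ (4 * (4 * e))); first by rewrite ler_pM2l.
      apply: (@le_trans _ _ (4 * (4 * c))); first by rewrite !ler_pM2l.
      by rewrite mulrA -natrM /c mulrC divfK.
    by apply: norm_le_of_sqr hqr; apply: divr_ge0 => //; exact: ltW.
  exact: skew_combine (small k l) (small l k).
exact: continuity_combine eta0 chiS Seta h1 h2 h3.
Qed.

End risk_continuity.

(** * The lower bound *)

Section real_estimates.
Context (R : realType).
Implicit Types x y z : R.

Lemma rotation_cost_small (K h S : R) : 0 <= K -> 0 <= h -> h <= 1 -> 8 * K * h <= 1 ->
  S <= K * (h * (1 + h)) -> S <= 1 / 4.
Proof.
move=> K0 h0 h1 Kh SK.
have e : K * h * h <= K * h by rewrite ler_piMr// mulr_ge0.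
lra.
Qed.

Lemma rotation_cost_le (p K h S : R) : 0 <= p -> 0 <= K -> 0 <= h -> h <= 1 -> 0 <= S ->
  S <= K * (h * (1 + h)) ->
  p * S * (1 + 8 * S) <= p * K * h * (1 + (1 + 32 * K) * h).
Proof.
move=> p0 K0 h0 h1 S0 SK; rewrite -!mulrA ler_wpM2l//.
have Kh0 : 0 <= K * h by rewrite mulr_ge0.
have Khh : K * h * h <= K * h by rewrite ler_piMr.
have S2 : S <= 2 * (K * h) by lra.
have e1 : S * (1 + 8 * S) <= (K * (h * (1 + h))) * (1 + 16 * (K * h)).
  by apply: ler_pM => //; lra.
apply: (le_trans e1).
have e2 : (1 + h) * (1 + 16 * (K * h)) <= 1 + (1 + 32 * K) * h.
  have : h * (16 * (K * h)) <= 16 * (K * h) by rewrite ler_piMl// mulr_ge0.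
  lra.
have := ler_wpM2l Kh0 e2; lra.
Qed.

(** At order [s] the hypothesis reads [4 D <= 2 mu r + 2 a r + 2 D]: drift against second moment,
    part of the drift lost to the risk, and divergence. The remaining terms have order [s ^+ 2] at
    least. The 9 is 1 from invariance, 4 from the cosine of the double angle and 4 from
    [1 - c <= s]. *)
Lemma divided_increment (s c a b mu D K r x : R) :
  0 < s -> s <= 1 -> 0 <= c -> c <= 1 -> 1 - s ^+ 2 <= c -> 0 <= a -> 0 <= b ->
  0 <= mu -> 0 <= K -> D = b * a -> 0 <= r -> c ^+ 2 - s ^+ 2 = 1 - 2 * s ^+ 2 ->
  x = 4 * mu * s ^+ 2 * (1 + K * s ^+ 2) ->
  - (D * s ^+ 2) <= 2 * (mu * s) * r + 6 * (mu * s) * (2 * s * c) * D +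
    2 * (1 - (c ^+ 2 - s ^+ 2)) * D - 2 * s * c * a * (2 * b - r) + D * (x / (2 * (mu * s))) ->
  0 < mu ->
  2 * D <= 2 * (mu + a) * r + s * (12 * mu * D + 9 * D + 2 * D * K).
Proof.
move=> s0 s1 c0 c1 cs a0 b0 mu0 K0 DE r0 c2 xE h mup.
have D0 : 0 <= D by rewrite DE mulr_ge0.
have ss : s ^+ 2 <= s by rewrite expr2 ler_piMl// ltW.
have xE' : x / (2 * (mu * s)) = 2 * s * (1 + K * s ^+ 2).
  by rewrite xE; field; rewrite !gt_eqF.
rewrite c2 xE' in h.
have {}h : s * (2 * c * a * (2 * b - r)) <=
    s * (2 * mu * r + 12 * mu * (s * c) * D + 5 * s * D + 2 * D * (1 + K * s ^+ 2)).
  by move: h; rewrite expr2; lra.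
rewrite ler_pM2l// in h.
have e1 : mu * D * (s * c) <= mu * D * s.
  by rewrite ler_wpM2l ?mulr_ge0// ler_piMr// ltW.
have e2 : D * K * s ^+ 2 <= D * K * s by rewrite ler_wpM2l// mulr_ge0.
have e3 : (1 - c) * D <= s * D by rewrite ler_wpM2r//; lra.
have e4 : 0 <= (1 - c) * (a * r) by rewrite !mulr_ge0// subr_ge0.
have e5 : 2 * c * a * (2 * b - r) =
    4 * D - 4 * ((1 - c) * D) - 2 * (a * r) + 2 * ((1 - c) * (a * r)).
  by rewrite DE; ring.
rewrite e5 in h.
lra.
Qed.

Lemma averaging_contradiction (b M D m t e U V : R) :
  0 <= e -> 0 <= m -> M * U + e * m < b * D * m ->
  b * (2 * D * m) <= 2 * M * V + b * (t * m) -> M * V <= M * U ->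
  b * t * m <= e * m -> False.
Proof.
move=> e0 m0 h1 h2 h3 h4; have em0 : 0 <= e * m by exact: mulr_ge0.
lra.
Qed.

End real_estimates.

Section lower_bound.
Context disp (T : measurableType disp) (R : realType) (P : probability T R).
Variables (n d : nat) (p sigma : R) (A : edge n -> {RV P >-> bool})
  (W : edge n -> 'I_d -> 'I_d -> {RV P >-> R}).
Hypotheses (n_gt0 : (0 < n)%N) (d_gt0 : (0 < d)%N).
Hypotheses (p_gt0 : 0 < p) (p_le1 : p <= 1) (sigma_gt0 : 0 < sigma).
Hypothesis AW : sync_model p A W.
Variable Zhat : data R n d -> 'I_n -> 'M[R]_d.
Hypothesis hZhat : estimator Zhat.

Notation params := ('I_n -> 'M[R]_d).
Notation skew_mean := (skew_mean sigma A W Zhat).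
Notation pair_risk := (pair_risk sigma A W Zhat).

(** To leading order [kappa * s ^+ 2] bounds the total squared displacement of the signals in units
    of the noise; [p * kappa] is [4 * mu]. *)
Let kappa : R := 4 * n%:R / sigma ^+ 2.
Let mu : R := n%:R * p / sigma ^+ 2.
Let D : R := d%:R * (d%:R - 1).

Let kappa_ge0 : 0 <= kappa.
Proof. by rewrite divr_ge0 ?sqr_ge0// mulr_ge0. Qed.

Let mu_gt0 : 0 < mu.
Proof. by rewrite divr_gt0 ?exprn_gt0// mulr_gt0// ltr0n. Qed.

Let d1_ge0 : 0 <= d%:R - 1 :> R.
Proof. by rewrite subr_ge0 ler1n. Qed.

Lemma chi2_rotation (Z : params) i j k l c s :
  parameter_space Z -> k != l -> c ^+ 2 + s ^+ 2 = 1 -> c <= 1 -> 1 - s ^+ 2 <= c ->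
  s ^+ 2 <= 1 -> 8 * kappa * s ^+ 2 <= 1 ->
  chi2 p sigma Z (translate Z (pair_rotation i j k l c s)) <=
  4 * mu * s ^+ 2 * (1 + (1 + 32 * kappa) * s ^+ 2).
Proof.
move=> hZ kl cs c1 c2 s1 ks.
set g := pair_rotation i j k l c s.
have hg : parameter_space g by exact: pair_rotation_in.
set S := (\sum_(e : edge n) sqnorm (signal (translate Z g) e - signal Z e)) / sigma ^+ 2.
have S0 : 0 <= S.
  by rewrite divr_ge0 ?sqr_ge0// sumr_ge0// => q _; exact: sqnorm_ge0.
have SK : S <= kappa * (s ^+ 2 * (1 + s ^+ 2)).
  rewrite /S ler_pdivrMr ?exprn_gt0//.
  apply: (le_trans (sum_signal_translate hZ hg)).
  rewrite (_ : kappa * (s ^+ 2 * (1 + s ^+ 2)) * sigma ^+ 2 =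
    n%:R * (4 * (s ^+ 2 + (s ^+ 2) ^+ 2))); last first.
    by rewrite /kappa; field; rewrite gt_eqF.
  rewrite ler_wpM2l//; apply: (le_trans (sum_pair_rotation i j kl cs)).
  rewrite ler_pM2l// lerD2l ler_sqr ?nnegrE ?sqr_ge0 ?subr_ge0//.
  by rewrite lerBlDr addrC -lerBlDr.
have s20 : 0 <= s ^+ 2 := sqr_ge0 s.
have S4 := rotation_cost_small kappa_ge0 s20 s1 ks SK.
apply: (le_trans (chi2_le p_gt0 p_le1 S4)); rewrite -/S.
apply: (le_trans (rotation_cost_le (ltW p_gt0) kappa_ge0 s20 s1 S0 SK)).
rewrite le_eqVlt; apply/orP; left; apply/eqP; congr (_ * _ * _).
by rewrite /kappa /mu; field; rewrite gt_eqF.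
Qed.

Let slack : R := 12 * mu * D + 9 * D + 2 * D * (1 + 32 * kappa).

Lemma average_pair_risk (I : finType) (N : I -> params) (s : R) i j :
  (0 < #|I|)%N -> (forall x, parameter_space (N x)) ->
  (forall g, parameter_space g -> exists f : I -> I, injective f /\
    forall x k l, skew_mean (N (f x)) i j k l <=
      skew_mean (translate (N x) g) i j k l + s ^+ 2) ->
  0 < s -> 2 * s ^+ 2 <= 1 -> 8 * kappa * s ^+ 2 <= 1 -> i != j ->
  2 * D * #|I|%:R <=
  2 * (mu + (d%:R - 1)) * (\sum_x pair_risk (N x) i j) + s * slack * #|I|%:R.
Proof.
move=> I0 NP Ninv s0 s12 ks ij.
have m0 : 0 < #|I|%:R :> R by rewrite ltr0n.
have s20 : 0 <= s ^+ 2 := sqr_ge0 s.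
have s21 : s ^+ 2 <= 1 by lra.
have s1 : s <= 1 by rewrite -(@ler_pXn2r _ 2) ?expr1n// nnegrE; exact: ltW.
(* The rotation is parametrized by its sine; [2 * s ^+ 2 <= 1] makes the cosine of the double angle
   non-negative. *)
pose c := Num.sqrt (1 - s ^+ 2).
have c0 : 0 <= c by exact: sqrtr_ge0.
have cE : c ^+ 2 = 1 - s ^+ 2 by rewrite sqr_sqrtr// subr_ge0.
have cs : c ^+ 2 + s ^+ 2 = 1 by rewrite cE subrK.
have c1 : c <= 1.
  by rewrite -(@ler_pXn2r _ 2) ?nnegrE// expr1n cE lerBlDr lerDl.
have cc : 1 - s ^+ 2 <= c by rewrite -cE expr2 ler_piMl.
have c2 : c ^+ 2 - s ^+ 2 = 1 - 2 * s ^+ 2 by rewrite cE; ring.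
have c20 : 0 <= c ^+ 2 - s ^+ 2 by rewrite c2 subr_ge0.
pose lam := mu * s.
have lam0 : 0 < lam by rewrite mulr_gt0.
pose X := 4 * mu * s ^+ 2 * (1 + (1 + 32 * kappa) * s ^+ 2).
pose g (q : 'I_d * 'I_d) := pair_rotation i j q.1 q.2 c s : params.
have gP q : q.1 != q.2 -> parameter_space (g q) by move=> q12; exact: pair_rotation_in.
pose inc x := \sum_(q : 'I_d * 'I_d | q.1 != q.2)
  (skew_mean (translate (N x) (g q)) i j q.1 q.2 - skew_mean (N x) i j q.1 q.2).
(* An injection of the finite net into itself is a permutation, so reindexing by it cancels the two
   sums up to [s ^+ 2] per point and plane. *)
have inc_lb : - (D * s ^+ 2) * #|I|%:R <= \sum_x inc x.
  rewrite exchange_big/=.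
  apply: (@le_trans _ _ (\sum_(q : 'I_d * 'I_d | q.1 != q.2) - (#|I|%:R * s ^+ 2))).
    rewrite sum_off_diagonal_cst le_eqVlt; apply/orP; left; apply/eqP.
    by rewrite /D; ring.
  apply: ler_sum => q q12; have [f [injf fP]] := Ninv _ (gP _ q12).
  rewrite sumrB [X in _ - X](reindex_inj injf)/=.
  rewrite lerBrDr addrC lerBlDr.
  rewrite mulr_natl -sumr_const -big_split/=.
  by apply: ler_sum => x _; exact: fP.
have inc_ub x : inc x <= 2 * lam * pair_risk (N x) i j + 6 * lam * (2 * s * c) * D +
    2 * (1 - (c ^+ 2 - s ^+ 2)) * D -
    2 * s * c * (d%:R - 1) * (2 * d%:R - pair_risk (N x) i j) + D * (X / (2 * lam)).
  apply: (skew_mean_increment p_gt0 p_le1 sigma_gt0 AW hZhat) => //; first exact: ltW.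
  by move=> k l kl; exact: chi2_rotation.
pose r := (\sum_x pair_risk (N x) i j) / #|I|%:R.
have r0 : 0 <= r.
  by rewrite divr_ge0// sumr_ge0// => x _; exact: pair_risk_ge0.
have rE : \sum_x pair_risk (N x) i j = r * #|I|%:R by rewrite /r divfK// gt_eqF.
have avg : - (D * s ^+ 2) <= 2 * lam * r + 6 * lam * (2 * s * c) * D +
    2 * (1 - (c ^+ 2 - s ^+ 2)) * D - 2 * s * c * (d%:R - 1) * (2 * d%:R - r) +
    D * (X / (2 * lam)).
  rewrite -(ler_pM2r m0); apply: (le_trans inc_lb).
  apply: (le_trans (ler_sum _ (fun x _ => inc_ub x))).
  rewrite le_eqVlt; apply/orP; left; apply/eqP.
  set C1 := 6 * lam * (2 * s * c) * D; set C2 := 2 * (1 - _) * D.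
  set C3 := 2 * s * c * (d%:R - 1); set C4 := D * (X / _).
  transitivity (\sum_x ((2 * lam + C3) * pair_risk (N x) i j + (C1 + C2 - C3 * (2 * d%:R) + C4))).
    by apply: eq_bigr => x _; ring.
  rewrite big_split/= -mulr_sumr rE sumr_const -(mulr_natr _ #|I|).
  by ring.
have := divided_increment s0 s1 c0 c1 cc d1_ge0 (ler0n R d) (ltW mu_gt0)
  (_ : 0 <= 1 + 32 * kappa) (erefl D) r0 c2 (erefl X) avg mu_gt0.
rewrite -/slack => h; rewrite rE.
have {}h : 2 * D <= 2 * (mu + (d%:R - 1)) * r + s * slack.
  by apply: h; rewrite addr_ge0// mulr_ge0.
rewrite -(ler_pM2r m0) in h; apply: (le_trans h).
by rewrite mulrDl -!mulrA.
Qed.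

Lemma sum_pair_risk_ge (e : R) : 0 < e -> exists2 Z : params, parameter_space Z &
  n%:R * (n%:R - 1) * D <= (mu + (d%:R - 1)) * (\sum_i \sum_j pair_risk Z i j) + e.
Proof.
move=> e0.
have D0 : 0 <= D by rewrite mulr_ge0.
have slack0 : 0 <= slack.
  have h1 : 0 <= 12 * mu * D by apply: mulr_ge0 => //; apply: mulr_ge0 => //; exact: ltW.
  have h2 : 0 <= 9 * D by exact: mulr_ge0.
  have h3 : 0 <= 2 * D * (1 + 32 * kappa).
    by apply: mulr_ge0; [exact: mulr_ge0|apply: addr_ge0 => //; exact: mulr_ge0].
  by rewrite /slack; apply: addr_ge0 => //; exact: addr_ge0.
(* The sine of the rotation. The three bounds make the angle admissible, keep the divergence in its
   linear range, and bring the slack of all pairs together below [e]; each added 1 avoids a zero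
   denominator. *)
pose a := Num.min (1 / 2) (Num.min (1 / (8 * kappa + 1)) (e / (n%:R * n%:R * slack + 1))).
have pos1 : 0 < 8 * kappa + 1 by rewrite ltr_wpDl// mulr_ge0.
have pos2 : 0 < n%:R * n%:R * slack + 1 :> R by rewrite ltr_wpDl// !mulr_ge0.
have a0 : 0 < a by rewrite !lt_min !divr_gt0.
have a1 : a <= 1 / 2 by rewrite ge_min lexx.
have a2 : a * (8 * kappa + 1) <= 1.
  by rewrite -ler_pdivlMr// !ge_min lexx orbT.
have a3 : a * (n%:R * n%:R * slack + 1) <= e.
  by rewrite -ler_pdivlMr// !ge_min lexx !orbT.
have aa : a ^+ 2 <= a by rewrite expr2 ler_piMl ?ltW//; lra.
have ka : 8 * kappa * a ^+ 2 <= 1.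
  have : kappa * a ^+ 2 <= kappa * a by rewrite ler_wpM2l.
  lra.
have [eps eps0 cont] := skew_mean_continuous p_gt0 p_le1 sigma_gt0 AW hZhat
  (exprn_gt0 2 a0).
have [I [N [I0 NP Ninv]]] := almost_invariant_net n d eps0.
have m0 : 0 < #|I|%:R :> R by rewrite ltr0n.
have pairs i j : i != j -> 2 * D * #|I|%:R <=
    2 * (mu + (d%:R - 1)) * (\sum_x pair_risk (N x) i j) + a * slack * #|I|%:R.
  move=> ij; apply: average_pair_risk => //; last lra.
  move=> g hg; have [f [injf fP]] := Ninv g hg.
  exists f; split => // x k l; apply: cont => //.
  exact: translate_in.
have [/existsP[x hx]|/existsPn none] := boolP [exists x,
    n%:R * (n%:R - 1) * D <= (mu + (d%:R - 1)) * (\sum_i \sum_j pair_risk (N x) i j) + e].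
  by exists (N x).
exfalso.
have pos i j x : 0 <= pair_risk (N x) i j by exact: pair_risk_ge0.
have M0 : 0 <= mu + (d%:R - 1) by rewrite addr_ge0// ltW.
(* If every point of the net fell short, so would their sum, contradicting the averaged inequalities
   summed over pairs. *)
have lt1 : \sum_x ((mu + (d%:R - 1)) * (\sum_i \sum_j pair_risk (N x) i j) + e) <
    \sum_(x : I) (n%:R * (n%:R - 1) * D).
  have [x0 _] := card_gt0P I0.
  apply: ltr_sum; first by apply/hasP; exists x0; rewrite ?mem_index_enum.
  by move=> x _; have := none x; rewrite -ltNge.
have tot : \sum_(q : 'I_n * 'I_n | q.1 != q.2) (2 * D * #|I|%:R) <=
    \sum_(q : 'I_n * 'I_n | q.1 != q.2)
     (2 * (mu + (d%:R - 1)) * (\sum_x pair_risk (N x) q.1 q.2) + a * slack * #|I|%:R).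
  by apply: ler_sum => q q12; exact: pairs.
rewrite sum_off_diagonal_cst big_split/= sum_off_diagonal_cst -mulr_sumr in tot.
have le2 : \sum_(q : 'I_n * 'I_n | q.1 != q.2) (\sum_x pair_risk (N x) q.1 q.2) <=
    \sum_x \sum_i \sum_j pair_risk (N x) i j.
  rewrite (sum_off_diagonal (fun i j => \sum_x pair_risk (N x) i j)).
  under eq_bigr do rewrite exchange_big/=.
  rewrite exchange_big/= gerBl sumr_ge0// => i _; exact: sumr_ge0.
rewrite big_split/= -mulr_sumr !sumr_const -(mulr_natr e) -(mulr_natr (_ * D)) in lt1.
have {}le2 := ler_wpM2l M0 le2.
have h3 : n%:R * (n%:R - 1) * (a * slack) <= e.
  apply: le_trans a3; rewrite [leRHS]mulrDr mulr1 [leLHS]mulrCA -[leLHS]addr0.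
  apply: lerD; last exact: ltW.
  apply: ler_wpM2l; first exact: ltW.
  by apply: ler_wpM2r => //; apply: ler_wpM2l => //; rewrite gerBl.
have h4 := ler_wpM2r (ltW m0) h3.
exact: averaging_contradiction (ltW e0) (ltW m0) lt1 tot le2 h4.
Qed.

End lower_bound.

(** * From pair risks to the minimax risk *)

(** Used with [v = 1 / n], [w = sigma^2 / (n p)] and [b = d - 1]. The core is
    [(1 - v - b * w) * (1 + b * w) <= 1 - v]. *)
Lemma minimax_constant_le (R : realType) (C b v w D : R) :
  1 <= C -> 0 <= b -> b <= C -> 0 <= v -> 0 < w -> 0 <= D ->
  (1 - C * (v + w)) * (w * D / 2) <= (1 - v) / 2 * (D / (w^-1 + b)).
Proof.
move=> C1 b0 bC v0 w0 D0.
have bw0 : 0 <= b * w by rewrite mulr_ge0// ltW.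
have pos : 0 < 1 + b * w by rewrite ltr_wpDr.
have -> : (1 - v) / 2 * (D / (w^-1 + b)) = (1 - v) / (1 + b * w) * (w * D / 2).
  have w1 : w^-1 + b = (1 + b * w) / w by rewrite mulrDl mulfK ?gt_eqF// mul1r.
  by rewrite w1; field; rewrite !gt_eqF.
apply: ler_wpM2r; first by rewrite divr_ge0// mulr_ge0// ltW.
rewrite ler_pdivlMr//.
have e1 : 1 - C * (v + w) <= 1 - v - b * w.
  have : v <= C * v by rewrite ler_peMl.
  have : b * w <= C * w by rewrite ler_wpM2r// ltW.
  lra.
apply: (le_trans (ler_wpM2r (ltW pos) e1)).
have : 0 <= b * w * (v + b * w) by rewrite mulr_ge0// addr_ge0.
lra.
Qed.

(** The loss is an infimum over a continuum of rotations. The integral of a non-negative function is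
    a supremum over the simple functions below it, which is monotone for arbitrary functions. *)
Lemma le_integral_nonmeasurable disp (T : measurableType disp) (R : realType)
    (mu : {measure set T -> \bar R}) (f g : T -> \bar R) :
  (forall t, (0 <= f t)%E) -> (forall t, (f t <= g t)%E) ->
  (\int[mu]_t f t <= \int[mu]_t g t)%E.
Proof.
move=> f0 fg; rewrite !ge0_integralTE//; last by move=> t; exact: le_trans (fg t).
by apply: le_ereal_sup => _ [h hf <-]; exists h => // t; exact: le_trans (fg t).
Qed.

Section risk.
Context disp (T : measurableType disp) (R : realType) (P : probability T R).
Variables (n d : nat) (p sigma : R) (A : edge n -> {RV P >-> bool})
  (W : edge n -> 'I_d -> 'I_d -> {RV P >-> R}).
Hypothesis n_gt0 : (0 < n)%N.
Variable Zhat : data R n d -> 'I_n -> 'M[R]_d.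
Hypothesis hZhat : estimator Zhat.

Lemma sync_risk_ge (Z : 'I_n -> 'M[R]_d) : parameter_space Z ->
  (((2 * n%:R ^+ 2)^-1 * \sum_i \sum_j pair_risk sigma A W Zhat Z i j)%:E
    <= sync_risk sigma A W Zhat Z)%E.
Proof.
move=> hZ.
have adm i j := admissible_pair_error hZhat Z i j.
have adm1 i : admissible (fun y => \sum_j pair_error (Zhat y) Z i j).
  exact: admissible_sum.
have adm2 : admissible (fun y => \sum_i \sum_j pair_error (Zhat y) Z i j).
  exact: admissible_sum.
have -> : (2 * n%:R ^+ 2)^-1 * \sum_i \sum_j pair_risk sigma A W Zhat Z i j =
    mean sigma A W Z (fun y => (2 * n%:R ^+ 2)^-1 * \sum_i \sum_j pair_error (Zhat y) Z i j).
  rewrite meanZ// mean_sum//; congr (_ * _); apply: eq_bigr => i _.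
  by rewrite mean_sum.
rewrite EFin_mean; last exact: admissibleZ.
rewrite /sync_risk expectation.unlock; apply: le_integral_nonmeasurable => t.
  rewrite lee_fin; apply: mulr_ge0.
    by rewrite invr_ge0; apply: mulr_ge0 => //; exact: sqr_ge0.
  by do 2 apply: sumr_ge0 => ? _; exact: sqnorm_ge0.
by rewrite lee_fin; apply: sync_loss_ge => //; exact: hZhat.1.
Qed.

End risk.

Theorem theorem3p1 (R : realType) (C1 : R) (hC1 : 2 <= C1) :
  exists c C : R, 0 < c /\ 0 < C /\
    forall (n d : nat) (p sigma : R),
      (2 <= n)%N -> 0 < p -> p <= 1 -> 0 < sigma ->
      c <= n%:R * p / sigma ^+ 2 ->
      (2 <= d)%N -> d%:R <= C1 ->
    forall (disp : measure_display) (T : measurableType disp)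
      (P : probability T R)
      (A : edge n -> {RV P >-> bool})
      (W : edge n -> 'I_d -> 'I_d -> {RV P >-> R}),
      sync_model p A W ->
      (((1 - C * (1 / n%:R + sigma ^+ 2 / (n%:R * p)))
        * (sigma ^+ 2 * d%:R * (d%:R - 1) / (2 * n%:R * p)))%:E
       <= minimax_risk sigma A W)%E.
Proof.
(* [C1] dominates both 1, the coefficient of [1 / n], and [d - 1], the coefficient of
   [sigma^2 / (n p)]. *)
exists 1, C1; split => //; split; first by lra.
move=> n d p sigma n2 p0 p1 sigma0 _ d2 dC disp T P A W AW.
have n_gt0 : (0 < n)%N by exact: leq_trans n2.
have d_gt0 : (0 < d)%N by exact: leq_trans d2.
have n0 : 0 < n%:R :> R by rewrite ltr0n.
have d1 : 0 <= d%:R - 1 :> R by rewrite subr_ge0 ler1n.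
pose mu : R := n%:R * p / sigma ^+ 2.
have mu0 : 0 < mu by rewrite divr_gt0 ?exprn_gt0// mulr_gt0.
pose D : R := d%:R * (d%:R - 1).
have M0 : 0 < mu + (d%:R - 1) by rewrite ltr_wpDr.
apply: le_ereal_inf_tmp => _ [Zhat hZhat <-].
(* [(1 - 1 / n) / 2] is the number [n (n - 1)] of ordered pairs over the [2 n^2] of
   [sync_loss_ge]. *)
apply: (@le_trans _ _ ((1 - n%:R^-1) / 2 * (D / (mu + (d%:R - 1))))%:E).
  rewrite lee_fin.
  have := @minimax_constant_le R C1 (d%:R - 1) n%:R^-1 mu^-1 D.
  rewrite invrK (_ : mu^-1 * D / 2 = sigma ^+ 2 * d%:R * (d%:R - 1) / (2 * n%:R * p)); last first.
    by rewrite /mu /D; field; rewrite !gt_eqF.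
  rewrite (_ : mu^-1 = sigma ^+ 2 / (n%:R * p)); last by rewrite /mu invf_div.
  rewrite div1r; apply => //; first by lra.
  - by rewrite lerBlDr (le_trans dC)// lerDl.
  - by rewrite divr_gt0 ?exprn_gt0// mulr_gt0.
  - by rewrite mulr_ge0.
(* The net yields a [Z] whose risk reaches the bound up to [eps]; the supremum over [Z] is thus
   above the bound minus every [eps]. *)
apply/lee_addgt0Pr => eps eps0.
have k0 : 0 < 2 * n%:R ^+ 2 :> R by rewrite mulr_gt0// exprn_gt0.
have [Z hZ hsum] := sum_pair_risk_ge n_gt0 d_gt0 p0 p1 sigma0 AW hZhat
  (mulr_gt0 eps0 (mulr_gt0 k0 M0)).
have hr := @sync_risk_ge _ T R P n d sigma A W n_gt0 Zhat hZhat Z hZ.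
apply: (@le_trans _ _ (sync_risk sigma A W Zhat Z + eps%:E)%E); last first.
  by rewrite leeD2r//; apply: ereal_sup_ubound; exists Z.
apply: le_trans (leeD2r _ hr); rewrite -EFinD lee_fin.
rewrite -/mu -/D in hsum.
set S := \sum_i _ in hsum *.
have -> : (1 - n%:R^-1) / 2 * (D / (mu + (d%:R - 1))) =
    n%:R * (n%:R - 1) * D / (2 * n%:R ^+ 2 * (mu + (d%:R - 1))).
  by field; rewrite !gt_eqF.
rewrite ler_pdivrMr ?mulr_gt0//; apply: (le_trans hsum).
rewrite le_eqVlt; apply/orP; left; apply/eqP.
by field; rewrite !gt_eqF.
Qed.
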